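(* Let $\mathbb K$ be an uncountable algebraically closed field, let $f:\mathbb N^k\to\mathbb N^\ell$ be a surjective monoid homomorphism, and let $\Gamma$ be a row-finite $\ell$-graph with no sources and finitely many vertices which is strongly aperiodic. Put $A=\mathrm{KP}_{\mathbb K}(f^*\Gamma)$ and $H=\ker\bar f$ (free abelian), let $r=\mathrm{rank}\,H$, and choose a basis $h_1,\dots,h_r$ of $H$. For $T\in\mathrm{MT}(\Gamma)$ and $a=(a_1,\dots,a_r)\in(\mathbb K^\times)^r$, let $P_{T,a}$ be the two-sided ideal $$P_{T,a}=\bigl\langle p_v\ (v\in\Gamma^0\setminus T),\ U_{h_i}-a_i1\ (1\le i\le r)\bigr\rangle$$ of $A$. Then the ideals $P_{T,a}$ exhaust the primitive ideals of $A$, and under these coordinates (i.e. via $(T,a)\mapsto P_{T,a}$) there is a homeomorphism $$\mathrm{Prim}\,A\cong\mathrm{MT}(\Gamma)\times(\mathbb K^\times)^r,$$ where $\mathrm{Prim}\,A$ has the hull-kernel topology, $\mathrm{MT}(\Gamma)$ has the topology with basis $\mathcal S(v)=\{T\in\mathrm{MT}(\Gamma):v\in T\}$ $(v\in\Gamma^0)$, $(\mathbb K^\times)^r$ has the Zariski topology, and the product has the product topology.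
   Context: $\mathbb N$ contains $0$. A $k$-graph is a countable small category $\Lambda$ with a functor $d:\Lambda\to\mathbb N^k$ satisfying the factorisation property: if $d(\lambda)=m+n$ there are unique composable $\mu,\nu$ with $\lambda=\mu\nu$, $d(\mu)=m$, $d(\nu)=n$. Objects are identified with $\Lambda^0=d^{-1}(0)$ (vertices); $r,s$ are range and source, and $\mu\nu$ is defined when $s(\mu)=r(\nu)$. Put $v\Lambda^n=\{\lambda: d(\lambda)=n,\ r(\lambda)=v\}$ and $v\Lambda w=\{\lambda:r(\lambda)=v,\ s(\lambda)=w\}$. $\Lambda$ is row-finite if every $v\Lambda^n$ is finite, and has no sources if every $v\Lambda^n$ is nonempty. For a commutative unital ring $R$ and a row-finite $k$-graph $\Lambda$ with no sources, $\mathrm{KP}_R(\Lambda)$ is the universal $R$-algebra generated by $\{p_v:v\in\Lambda^0\}\cup\{s_\lambda,s_{\lambda^*}:\lambda\in\Lambda\setminus\Lambda^0\}$, with $s_v=s_{v^*}=p_v$, subject to: (KP1) the $p_v$ are mutually orthogonal idempotents; (KP2) $s_\lambda s_\mu=s_{\lambda\mu}$ and $s_{\mu^*}s_{\lambda^*}=s_{(\lambda\mu)^*}$ whenever $\lambda\mu$ is defined, and $p_{r(\lambda)}s_\lambda=s_\lambda=s_\lambda p_{s(\lambda)}$, $p_{s(\lambda)}s_{\lambda^*}=s_{\lambda^*}=s_{\lambda^*}p_{r(\lambda)}$; (KP3) if $d(\lambda)=d(\mu)$ then $s_{\lambda^*}s_\mu=\delta_{\lambda,\mu}p_{s(\lambda)}$;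 (KP4) $p_v=\sum_{\lambda\in v\Lambda^n}s_\lambda s_{\lambda^*}$ for $v\in\Lambda^0$, $0\ne n\in\mathbb N^k$. It is unital, with $1=\sum_v p_v$, when $\Lambda^0$ is finite. Infinite paths: $\Gamma^\infty$ is the set of degree-preserving functors $x:\{(p,q):p\le q\in\mathbb N^\ell\}\to\Gamma$ (with $d(x(p,q))=q-p$); $x(n)=x(n,n)$, $v\Gamma^\infty=\{x:x(0)=v\}$, and $(\sigma^mx)(p,q)=x(p+m,q+m)$. An $\ell$-graph $\Gamma$ is aperiodic if for every $v\in\Gamma^0$ there is $x\in v\Gamma^\infty$ with $\sigma^mx\ne\sigma^nx$ whenever $m\ne n$. A set $L\subseteq\Gamma^0$ is hereditary if $v\in L$, $v\Gamma w\ne\varnothing$ imply $w\in L$; it is saturated if $v\in L$ whenever $s(v\Gamma^n)\subseteq L$ for some $0\ne n\in\mathbb N^\ell$. For saturated hereditary $L$, $\Gamma\setminus L=\{\lambda\in\Gamma:s(\lambda)\notin L\}$, an $\ell$-graph with vertex set $\Gamma^0\setminus L$. $\Gamma$ is strongly aperiodic if $\Gamma\setminus L$ is aperiodic for every proper saturated hereditary $L\subsetneq\Gamma^0$. A maximal tail is a nonempty $T\subseteq\Gamma^0$ with: (MT1) $w\in T$, $v\Gamma w\ne\varnothing$ imply $v\in T$; (MT2) for $v\in T$, $n\in\mathbb N^\ell$ there is $\lambda\in v\Gamma^n$ with $s(\lambda)\in T$; (MT3) for $v,w\in T$ there is $z\in T$ with $v\Gamma z\ne\varnothing$ and $w\Gamma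 z\ne\varnothing$. $\mathrm{MT}(\Gamma)$ is the set of maximal tails. Pullback: $f^*\Gamma=\{(\lambda,n)\in\Gamma\times\mathbb N^k:d(\lambda)=f(n)\}$, a $k$-graph with degree $d(\lambda,n)=n$ and product $(\lambda,n)(\mu,m)=(\lambda\mu,n+m)$; vertices $(v,0)$ are identified with $v\in\Gamma^0$. $\bar f:\mathbb Z^k\to\mathbb Z^\ell$ is the group completion of $f$. For $h\in H$ write $h=h_+-h_-$ (coordinatewise positive and negative parts) and put $U_h=\sum_{v\in\Gamma^0}\sum_{\lambda\in v\Gamma^{f(h_+)}}s_{(\lambda,h_+)}s_{(\lambda,h_-)^*}\in A$ (note $f(h_+)=f(h_-)$); these are central units of $A$. $\mathrm{Prim}\,A$ is the set of annihilators of simple left $A$-modules; its hull-kernel closed sets are $\{P:P\supseteq I\}$ for two-sided ideals $I$. *)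

(* Defs.v *)
From HB Require Import structures.
From mathcomp Require Import all_boot all_order all_algebra.
From mathcomp Require Import all_classical topology.
From mathcomp Require Import mpoly.

Set Implicit Arguments.
Unset Strict Implicit.
Unset Printing Implicit Defensive.

Import GRing.Theory.
Local Open Scope classical_set_scope.
Local Open Scope ring_scope.

Notation NN k := {ffun 'I_k -> nat}.
Notation ZZ k := {ffun 'I_k -> int}.

Definition leN k (p q : NN k) : bool := [forall i, (p i <= q i)%N].

(* Objects are kept as a separate type instead of as the degree-zero
   morphisms; the factorisation property makes [idp] a bijection onto the
   latter.  Arrows compose as in [x y] with [sc x = rg y]; the value of
   [cmp x y] at a non-composable pair is irrelevant junk. *)
Record kgraph (k : nat) := KGraph {
  vertex : countType;
  kpath : countType;
  rg : kpath -> vertex;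
  sc : kpath -> vertex;
  idp : vertex -> kpath;
  cmp : kpath -> kpath -> kpath;
  dg : kpath -> NN k;
  rg_idp : forall v, rg (idp v) = v;
  sc_idp : forall v, sc (idp v) = v;
  rg_cmp : forall x y, sc x = rg y -> rg (cmp x y) = rg x;
  sc_cmp : forall x y, sc x = rg y -> sc (cmp x y) = sc y;
  cmp_idl : forall x, cmp (idp (rg x)) x = x;
  cmp_idr : forall x, cmp x (idp (sc x)) = x;
  cmpA : forall x y z, sc x = rg y -> sc y = rg z ->
    cmp x (cmp y z) = cmp (cmp x y) z;
  dg_idp : forall v, dg (idp v) = 0;
  dg_cmp : forall x y, sc x = rg y -> dg (cmp x y) = dg x + dg y;
  factorisation : forall x m n, dg x = m + n ->
    exists! yz : kpath * kpath,
      [/\ sc yz.1 = rg yz.2, x = cmp yz.1 yz.2, dg yz.1 = m & dg yz.2 = n]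
}.

Section KGraphNotions.
Variables (k : nat) (G : kgraph k).
Implicit Types (v w : vertex G) (L : set (vertex G)).

Definition out v (n : NN k) : set (kpath G) := [set x | dg x = n /\ rg x = v].

Definition linked v w := exists x : kpath G, rg x = v /\ sc x = w.

Definition row_finite := forall v n, finite_set (out v n).

Definition no_sources := forall v n, out v n !=set0.

Definition hereditary L := forall v w, L v -> linked v w -> L w.

Definition saturated L :=
  forall v, (exists n, n != 0 /\ [set sc x | x in out v n] `<=` L) -> L v.

(* A degree-preserving functor on the poset N^k; composition reads from the
   range, so that x(p, q) has range x(p) and source x(q). *)
Record infpath := InfPath {
  ip_obj : NN k -> vertex G;
  ip_mor : forall p q, leN p q -> kpath G;
  ip_rg : forall p q (pq : leN p q), rg (ip_mor pq) = ip_obj p;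
  ip_sc : forall p q (pq : leN p q), sc (ip_mor pq) = ip_obj q;
  ip_id : forall p (pp : leN p p), ip_mor pp = idp (ip_obj p);
  ip_cmp : forall p q t (pq : leN p q) (qt : leN q t) (pt : leN p t),
    ip_mor pt = cmp (ip_mor pq) (ip_mor qt);
  ip_dg : forall p q (pq : leN p q),
    dg (ip_mor pq) = [ffun i => (q i - p i)%N]
}.

Lemma leN_add2r (m p q : NN k) : leN p q -> leN (p + m) (q + m).
Proof.
by move=> /forallP pq; apply/forallP => i; rewrite !ffunE leq_add2r.
Qed.

Program Definition pathshift (m : NN k) (x : infpath) : infpath :=
  @InfPath (fun n => ip_obj x (n + m))
    (fun p q pq => ip_mor x (leN_add2r m pq)) _ _ _ _ _.
Next Obligation. by move=> *; exact: ip_rg. Qed.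
Next Obligation. by move=> *; exact: ip_sc. Qed.
Next Obligation. by move=> *; exact: ip_id. Qed.
Next Obligation. by move=> *; exact: ip_cmp. Qed.
Next Obligation.
by move=> *; rewrite ip_dg; apply/ffunP => i; rewrite !ffunE subnDr.
Qed.

Definition aperiodic :=
  forall v, exists x : infpath, ip_obj x 0 = v /\
    forall m n, m <> n -> pathshift m x <> pathshift n x.

Record maxtail := MaxTail {
  mt_set :> set (vertex G);
  mt_nonempty : mt_set !=set0;
  mt1 : forall v w, mt_set w -> linked v w -> mt_set v;
  mt2 : forall v n, mt_set v -> exists x, out v n x /\ mt_set (sc x);
  mt3 : forall v w, mt_set v -> mt_set w ->
    exists z, [/\ mt_set z, linked v z & linked w z]
}.

End KGraphNotions.

Section Minus.
Variables (k : nat) (G : kgraph k) (L : set (vertex G)).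
Hypothesis hL : hereditary L.

Local Notation mvertex := {v : vertex G | v \notin L}.
Local Notation mpath := {x : kpath G | sc x \notin L}.

Lemma minus_rg_proof (x : mpath) : rg (val x) \notin L.
Proof.
apply/negP => /set_mem rL; have /negP := valP x; apply.
by apply/mem_set; apply: hL rL _; exists (val x).
Qed.

Lemma minus_idp_proof (v : mvertex) : sc (idp (val v)) \notin L.
Proof. by rewrite sc_idp (valP v). Qed.

Definition minus_rg (x : mpath) : mvertex :=
  exist (fun v => v \notin L) _ (minus_rg_proof x).
Definition minus_sc (x : mpath) : mvertex :=
  exist (fun v => v \notin L) _ (valP x).
Definition minus_idp (v : mvertex) : mpath :=
  exist (fun x => sc x \notin L) _ (minus_idp_proof v).
Definition minus_cmp (x y : mpath) : mpath := insubd x (cmp (val x) (val y)).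

Lemma minus_cmpE (x y : mpath) : minus_sc x = minus_rg y ->
  val (minus_cmp x y) = cmp (val x) (val y).
Proof.
move=> /(congr1 val) /= e.
by rewrite /minus_cmp val_insubd sc_cmp// (valP y).
Qed.

Program Definition kminus : kgraph k :=
  @KGraph k mvertex mpath minus_rg minus_sc minus_idp minus_cmp
    (fun x => dg (val x)) _ _ _ _ _ _ _ _ _ _.
Next Obligation. by move=> v; apply: val_inj; rewrite /= rg_idp. Qed.
Next Obligation. by move=> v; apply: val_inj; rewrite /= sc_idp. Qed.
Next Obligation.
move=> x y xy; apply: val_inj; rewrite /= minus_cmpE// rg_cmp//.
exact: (congr1 val xy).
Qed.
Next Obligation.
move=> x y xy; apply: val_inj; rewrite /= minus_cmpE// sc_cmp//.
exact: (congr1 val xy).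
Qed.
Next Obligation.
move=> x; apply: val_inj; rewrite minus_cmpE /= ?cmp_idl//.
by apply: val_inj; rewrite /= sc_idp.
Qed.
Next Obligation.
move=> x; apply: val_inj; rewrite minus_cmpE /= ?cmp_idr//.
by apply: val_inj; rewrite /= rg_idp.
Qed.
Next Obligation.
move=> x y z exy eyz.
have /= xy := congr1 val exy; have /= yz := congr1 val eyz.
apply: val_inj; rewrite !minus_cmpE ?cmpA//.
  by apply: val_inj; rewrite /= minus_cmpE// sc_cmp.
by apply: val_inj; rewrite /= minus_cmpE// rg_cmp.
Qed.
Next Obligation. by move=> v; exact: dg_idp. Qed.
Next Obligation.
move=> x y exy; have /= xy := congr1 val exy.
by rewrite minus_cmpE// dg_cmp.
Qed.
Next Obligation.
move=> x m n xmn.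
have [[y z] [[/= yz xyz dy dz] uniq]] := factorisation xmn.
have zL : sc z \notin L by rewrite -(sc_cmp yz) -xyz (valP x).
have yL : sc y \notin L.
  apply/negP => /set_mem syL; move/negP: zL; apply; apply/mem_set.
  by apply: hL syL _; exists z.
exists (exist _ y yL, exist _ z zL); split.
  have e : minus_sc (exist _ y yL) = minus_rg (exist _ z zL) by apply: val_inj.
  by split => //; apply: val_inj; rewrite minus_cmpE.
move=> [y' z'] [/= e exyz dy' dz'].
have [ey ez] : (y, z) = (val y', val z').
  apply: uniq; split => //=; first exact: (congr1 val e).
  by rewrite exyz minus_cmpE.
by congr pair; apply: val_inj.
Qed.

End Minus.

Definition strongly_aperiodic k (G : kgraph k) :=
  forall (L : set (vertex G)) (hL : hereditary L),
    saturated L -> L <> setT -> aperiodic (kminus hL).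

Section Pullback.
Variables (k l : nat) (f : {additive NN k -> NN l}) (G : kgraph l).

Local Notation pb_path := {z : kpath G * NN k | dg z.1 == f z.2}.

Lemma pb_idp_proof (v : vertex G) : dg (idp v, 0 : NN k).1 == f (idp v, 0).2.
Proof. by rewrite /= raddf0 dg_idp. Qed.

Definition pb_idp (v : vertex G) : pb_path :=
  exist (fun z => dg z.1 == f z.2) _ (pb_idp_proof v).
Definition pb_rg (x : pb_path) : vertex G := rg (val x).1.
Definition pb_sc (x : pb_path) : vertex G := sc (val x).1.
Definition pb_dg (x : pb_path) : NN k := (val x).2.
Definition pb_cmp (x y : pb_path) : pb_path :=
  insubd x (cmp (val x).1 (val y).1, (val x).2 + (val y).2).

Lemma pb_cmpE (x y : pb_path) : pb_sc x = pb_rg y ->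
  val (pb_cmp x y) = (cmp (val x).1 (val y).1, (val x).2 + (val y).2).
Proof.
move=> e; rewrite /pb_cmp val_insubd /= dg_cmp// raddfD /=.
by rewrite (eqP (valP x)) (eqP (valP y)) eqxx.
Qed.

(* The vertex (v, 0) is represented by v itself. *)
Program Definition pullback : kgraph k :=
  @KGraph k (vertex G) pb_path pb_rg pb_sc pb_idp pb_cmp pb_dg
    _ _ _ _ _ _ _ _ _ _.
Next Obligation. by move=> v; rewrite /pb_rg /= rg_idp. Qed.
Next Obligation. by move=> v; rewrite /pb_sc /= sc_idp. Qed.
Next Obligation. by move=> x y xy; rewrite {1}/pb_rg pb_cmpE// rg_cmp. Qed.
Next Obligation. by move=> x y xy; rewrite {1}/pb_sc pb_cmpE// sc_cmp. Qed.
Next Obligation.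
move=> x; apply: val_inj; rewrite pb_cmpE /=; last by rewrite /pb_sc /= sc_idp.
by rewrite cmp_idl add0r -surjective_pairing.
Qed.
Next Obligation.
move=> x; apply: val_inj; rewrite pb_cmpE /=; last by rewrite /pb_rg /= rg_idp.
by rewrite cmp_idr addr0 -surjective_pairing.
Qed.
Next Obligation.
move=> x y z xy yz.
have xyz1 : pb_sc (pb_cmp x y) = pb_rg z by rewrite {1}/pb_sc pb_cmpE// sc_cmp.
have xyz2 : pb_sc x = pb_rg (pb_cmp y z) by rewrite /pb_rg pb_cmpE// rg_cmp.
by apply: val_inj; rewrite !pb_cmpE //= cmpA// addrA.
Qed.
Next Obligation. by []. Qed.
Next Obligation. by move=> x y xy; rewrite /pb_dg pb_cmpE. Qed.
Next Obligation.
case=> -[x p] /= px m n; rewrite /pb_dg /= => pmn.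
have xmn : dg x = f m + f n by rewrite -raddfD -pmn; apply/eqP.
have [[y z] [[/= yz xyz dy dz] uniq]] := factorisation xmn.
have ym : dg (y, m).1 == f (y, m).2 by apply/eqP.
have zn : dg (z, n).1 == f (z, n).2 by apply/eqP.
exists (exist _ (y, m) ym, exist _ (z, n) zn); split.
  by split => //; apply: val_inj; rewrite pb_cmpE //= -xyz pmn.
move=> [[[y' m'] ym'] [[z' n'] zn']] [/= e /(congr1 val) exyz em en].
rewrite pb_cmpE //= in exyz; case: exyz => exyz _.
rewrite /pb_dg /= in em en; subst m' n'.
have [ey ez] : (y, z) = (y', z').
  by apply: uniq; split => //=; apply/eqP; [exact: ym' | exact: zn'].
by congr pair; apply: val_inj; rewrite /= ?ey ?ez.
Qed.

End Pullback.

(* A unital algebra over a commutative ring, given by its structure map into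
   the centre.  Unlike the library's [algType] it may be the zero ring, which
   is the Kumjian-Pask algebra of the empty graph. *)
Record ualg (R : comPzRingType) := UAlg {
  ualg_ring :> pzRingType;
  scal : {rmorphism R -> ualg_ring};
  scal_central : forall c x, scal c * x = x * scal c
}.

(* Homomorphisms of algebras that need not preserve the identity. *)
Definition alg_hom (R : comPzRingType) (A B : ualg R) (phi : A -> B) :=
  [/\ {morph phi : x y / x + y}, {morph phi : x y / x * y} &
      forall c x, phi (scal A c * x) = scal B c * phi x].

Section KumjianPask.
Variables (k : nat) (G : kgraph k) (R : comPzRingType).

(* [s] and [t] give s_x and s_{x^*}; they are total, with the convention
   s_v = s_{v^*} = p_v on vertices. *)
Record KP_family (A : ualg R) (p : vertex G -> A) (s t : kpath G -> A) : Prop :=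
  KPFamily {
  kp_s_idp : forall v, s (idp v) = p v;
  kp_t_idp : forall v, t (idp v) = p v;
  kp1 : forall v w, p v * p w = if v == w then p v else 0;
  kp2_s : forall x y, sc x = rg y -> s x * s y = s (cmp x y);
  kp2_t : forall x y, sc x = rg y -> t y * t x = t (cmp x y);
  kp2_ps : forall x, p (rg x) * s x = s x;
  kp2_sp : forall x, s x * p (sc x) = s x;
  kp2_pt : forall x, p (sc x) * t x = t x;
  kp2_tp : forall x, t x * p (rg x) = t x;
  kp3 : forall x y, dg x = dg y -> t x * s y = if x == y then p (sc x) else 0;
  kp4 : forall v n, n != 0 -> p v = \sum_(x \in out v n) s x * t x
}.

(* [A] with the generators [p], [s], [t] is the universal algebra of the graph
   among all, not necessarily unital, algebras: since a non-unital algebra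
   embeds in its unitisation, it is enough to test on unital targets, as long
   as the homomorphisms are not required to be unital. *)
Definition is_KP (A : ualg R) (p : vertex G -> A) (s t : kpath G -> A) :=
  KP_family p s t /\
  forall (B : ualg R) (q : vertex G -> B) (u w : kpath G -> B),
    KP_family q u w ->
    exists! phi : A -> B,
      [/\ alg_hom phi, forall v, phi (p v) = q v, forall x, phi (s x) = u x &
          forall x, phi (t x) = w x].

End KumjianPask.

Definition posp k (h : ZZ k) : NN k :=
  [ffun i => if 0 <= h i then `|h i|%N else 0%N].
Definition negp k (h : ZZ k) : NN k := posp (- h).
Definition toZZ k (n : NN k) : ZZ k := [ffun i => Posz (n i)].

Definition fbar k l (f : {additive NN k -> NN l}) (h : ZZ k) : ZZ l :=
  toZZ (f (posp h)) - toZZ (f (negp h)).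

Lemma toZZD k (m n : NN k) : toZZ (m + n) = toZZ m + toZZ n.
Proof. by apply/ffunP => i; rewrite !ffunE. Qed.

Lemma toZZ_inj k : injective (@toZZ k).
Proof.
by move=> m n /ffunP mn; apply/ffunP => i; have := mn i; rewrite !ffunE => -[].
Qed.

Lemma pospB k (h : ZZ k) : toZZ (posp h) - toZZ (negp h) = h.
Proof.
apply/ffunP => i; rewrite !ffunE.
by case: (h i) => [[|n]|n] //=; rewrite ?subr0 ?sub0r.
Qed.

(* The property that characterises the group completion of [f]. *)
Lemma fbar_toZZB k l (f : {additive NN k -> NN l}) (m n : NN k) :
  fbar f (toZZ m - toZZ n) = toZZ (f m) - toZZ (f n).
Proof.
set h := toZZ m - toZZ n.
have e : posp h + n = m + negp h.
  apply: toZZ_inj; rewrite !toZZD; apply/eqP.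
  by rewrite -subr_eq addrAC pospB /h subrK.
have /(congr1 (@toZZ l)) := congr1 f e; rewrite !raddfD !toZZD /fbar => fe.
apply/eqP; rewrite subr_eq addrAC eq_sym subr_eq; apply/eqP.
by rewrite fe.
Qed.

Definition zbasis k r (H : set (ZZ k)) (h : 'I_r -> ZZ k) :=
  (forall i, H (h i)) /\
  forall x, H x -> exists! c : ZZ r, x = \sum_(i < r) h i *~ c i.

Section Ideals.
Variable A : pzRingType.

Definition ideal2 (I : set A) :=
  [/\ I 0, forall x y, I x -> I y -> I (x + y),
      forall a x, I x -> I (a * x) & forall a x, I x -> I (x * a)].

Definition simple_module (M : lmodType A) :=
  (exists m : M, m <> 0) /\
  forall N : {pred M}, GRing.submod_closed N ->
    (forall m, m \in N -> m = 0) \/ (forall m, m \in N).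

Definition annihilator (M : lmodType A) : set A :=
  [set a | forall m : M, a *: m = 0].

Definition primitive (P : set A) :=
  exists M : lmodType A, simple_module M /\ P = annihilator M.

Lemma ideal2T : ideal2 setT. Proof. by []. Qed.

Lemma ideal2I I J : ideal2 I -> ideal2 J -> ideal2 (I `&` J).
Proof.
move=> [I0 ID Il Ir] [J0 JD Jl Jr]; split=> //.
- by move=> x y [? ?] [? ?]; split; [exact: ID | exact: JD].
- by move=> a x [? ?]; split; [exact: Il | exact: Jl].
- by move=> a x [? ?]; split; [exact: Ir | exact: Jr].
Qed.

Lemma ideal2_smallest (S : set A) : ideal2 (smallest ideal2 S).
Proof.
split.
- by move=> I [[]].
- move=> x y xS yS I IS; have [[_ ID _ _] _] := IS.
  by apply: ID; [exact: xS | exact: yS].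
- by move=> a x xS I IS; have [[_ _ Il _] _] := IS; apply: Il; exact: xS.
- by move=> a x xS I IS; have [[_ _ _ Ir] _] := IS; apply: Ir; exact: xS.
Qed.

Lemma primitive_proper P : primitive P -> ~ P 1.
Proof.
by move=> [M [[[m m0] _] ->]] /(_ m); rewrite scale1r.
Qed.

Lemma primitive_prime P I J : primitive P -> ideal2 I -> ideal2 J ->
  I `&` J `<=` P -> I `<=` P \/ J `<=` P.
Proof.
move=> [M [[_ sM] ->]] [I0 ID Il Ir] [J0 JD Jl Jr] IJ.
pose N : {pred M} := fun m => `[< forall a, I a -> a *: m = 0 >].
have NE m : m \in N <-> forall a, I a -> a *: m = 0.
  by split=> [/asboolP //|mN]; exact/asboolP.
have Ncl : GRing.submod_closed N.
  split; first by apply/NE => a _; rewrite scaler0.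
  move=> b u v /NE uN /NE vN; apply/NE => a Ia.
  rewrite scalerDr scalerA vN// addr0.
  by apply: uN; exact: Ir.
case: (sM N Ncl) => [N0|NT]; last by left => a Ia m; move/NE: (NT m); apply.
right => b Jb m; apply: N0; apply/NE => a Ia.
by rewrite scalerA; apply: IJ; split; [exact: Ir | exact: Jl].
Qed.

Record Prim := MkPrim {
  pideal :> set A;
  pidealP : primitive pideal
}.

HB.instance Definition _ := gen_eqMixin Prim.
HB.instance Definition _ := gen_choiceMixin Prim.

Definition hull (I : set A) : set Prim := [set P | I `<=` pideal P].

Definition hk_open : set (set Prim) :=
  [set U | exists I, ideal2 I /\ ~` U = hull I].

Lemma hk_openT : hk_open setT.
Proof.
exists setT; split; first exact: ideal2T.
apply/seteqP; split=> P //= TP; have := primitive_proper (pidealP P).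
by case; exact: TP.
Qed.

Lemma hk_openI : setI_closed hk_open.
Proof.
move=> U V [I [iI UI]] [J [iJ VJ]]; exists (I `&` J).
split; first exact: ideal2I.
rewrite setCI UI VJ; apply/seteqP; split=> P.
  by case=> sub x [Ix Jx]; [exact: sub Ix | exact: sub Jx].
move=> IJ; have [?|?] := primitive_prime (pidealP P) iI iJ IJ.
  by left.
by right.
Qed.

Lemma hk_open_bigU (T : Type) (F : T -> set Prim) :
  (forall i, hk_open (F i)) -> hk_open (\bigcup_i F i).
Proof.
move=> oF.
pose S : set A :=
  [set x | exists i I, [/\ ideal2 I, ~` F i = hull I & I x]].
exists (smallest ideal2 S); split; first exact: ideal2_smallest.
rewrite setC_bigcup; apply/seteqP; split=> P.
  move=> PF; apply: smallest_sub.
    have [M [_ eP]] := pidealP P; rewrite eP; split => /=.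
    - by move=> m; rewrite scale0r.
    - by move=> x y xm ym m; rewrite scalerDl xm ym addr0.
    - by move=> a x xm m; rewrite -scalerA xm scaler0.
    - by move=> a x xm m; rewrite -scalerA xm.
  move=> x [i [I [_ FI Ix]]].
  have : hull I P by rewrite -FI; apply: PF.
  exact.
move=> SP i _; have [I [iI FI]] := oF i.
rewrite FI => x Ix; apply: SP => J [_ SJ]; apply: SJ.
by exists i, I.
Qed.

HB.instance Definition _ :=
  isOpenTopological.Build Prim hk_openT hk_openI hk_open_bigU.

End Ideals.

Section MaxTailTopology.
Variables (k : nat) (G : kgraph k).

HB.instance Definition _ := gen_eqMixin (maxtail G).
HB.instance Definition _ := gen_choiceMixin (maxtail G).

Definition tails_at (v : vertex G) : set (maxtail G) := [set T | mt_set T v].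

(* The index set of the base has to be a pointed type, whereas the graph may
   have no vertex; [None] carries no basic open set. *)
Definition tails_base (v : option (vertex G)) : set (maxtail G) :=
  if v is Some v' then tails_at v' else set0.

Lemma tails_cover : \bigcup_(v in [set: option (vertex G)]) tails_base v = setT.
Proof.
apply/seteqP; split=> T // _.
by have [v Tv] := mt_nonempty T; exists (Some v).
Qed.

Lemma tails_join (u v : option (vertex G)) (T : maxtail G) :
  [set: option (vertex G)] u -> [set: option (vertex G)] v ->
  tails_base u T -> tails_base v T ->
  exists w, [/\ [set: option (vertex G)] w, tails_base w T &
    tails_base w `<=` tails_base u `&` tails_base v].
Proof.
case: u v => [u|] [v|] //= _ _ Tu Tv.
have [z [Tz uz vz]] := mt3 Tu Tv; exists (Some z); split=> // T' T'z.
by split; [exact: mt1 T'z uz | exact: mt1 T'z vz].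
Qed.

HB.instance Definition _ :=
  isBaseTopological.Build (maxtail G) tails_cover tails_join.

End MaxTailTopology.

Section Torus.
Variables (K : fieldType) (r : nat).

Record torus := Torus {
  tval :> 'I_r -> K;
  tvalP : forall i, tval i != 0
}.

HB.instance Definition _ := gen_eqMixin torus.
HB.instance Definition _ := gen_choiceMixin torus.

Definition zero_locus (S : set ({mpoly K[r]})) : set torus :=
  [set a | forall q, S q -> q.@[a] = 0].

Definition zariski_open : set (set torus) :=
  [set U | exists S, ~` U = zero_locus S].

Lemma zariski_openT : zariski_open setT.
Proof.
exists [set 1]; rewrite setCT; apply/seteqP; split=> a //= /(_ _ erefl).
by rewrite meval1 => /eqP; rewrite oner_eq0.
Qed.

Lemma zariski_openI : setI_closed zariski_open.
Proof.
move=> U V [S US] [S' VS'].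
exists [set q | exists q1 q2, [/\ S q1, S' q2 & q = q1 * q2]].
rewrite setCI US VS'; apply/seteqP; split=> a.
  by case=> aS _ [q1 [q2 [S1 S2 ->]]];
    rewrite mevalM ?(aS _ S1) ?(aS _ S2) ?mul0r ?mulr0.
move=> aSS; have [aS|] := pselect (zero_locus S a); first by left.
move=> /existsNP[q1 /not_implyP[S1 /eqP q1a]]; right => q2 S2.
have := aSS (q1 * q2); rewrite mevalM => /(_ _)/eqP.
by rewrite mulf_eq0 (negbTE q1a) => /(_ _)/eqP; apply; exists q1, q2.
Qed.

Lemma zariski_open_bigU (T : Type) (F : T -> set torus) :
  (forall i, zariski_open (F i)) -> zariski_open (\bigcup_i F i).
Proof.
move=> oF; exists [set q | exists i S, ~` F i = zero_locus S /\ S q].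
rewrite setC_bigcup; apply/seteqP; split=> a.
  move=> aF q [i [S [FS Sq]]].
  have : zero_locus S a by rewrite -FS; apply: aF.
  exact.
move=> aS i _; have [S FS] := oF i; rewrite FS => q Sq.
by apply: aS; exists i, S.
Qed.

HB.instance Definition _ :=
  isOpenTopological.Build torus zariski_openT zariski_openI zariski_open_bigU.

End Torus.

Definition homeomorphism (X Y : topologicalType) (g : X -> Y) :=
  exists g' : Y -> X, [/\ cancel g g', cancel g' g, continuous g & continuous g'].

Section IdealsOfPullback.
Variables (K : fieldType) (k l : nat) (f : {additive NN k -> NN l}).
Variables (G : kgraph l) (A : ualg K).
Variables (p : vertex (pullback f G) -> A) (s t : kpath (pullback f G) -> A).

(* [gen_at u x n] is [u (x, n)]; it is only used when [dg x = f n]. *)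
Definition gen_at (u : kpath (pullback f G) -> A) (x : kpath G) (n : NN k) :
    A :=
  if (insub (x, n) : option {z : kpath G * NN k | dg z.1 == f z.2}) is Some y
  then u y else 0.

Definition Uelt (h : ZZ k) : A :=
  \sum_(v \in [set: vertex G]) \sum_(x \in out v (f (posp h)))
    gen_at s x (posp h) * gen_at t x (negp h).

Definition PTa r (h : 'I_r -> ZZ k) (T : maxtail G) (a : torus K r) : set A :=
  smallest (@ideal2 A)
    ([set p v | v in ~` mt_set T] `|`
     [set Uelt (h i) - scal A (a i) | i in [set: 'I_r]]).

End IdealsOfPullback.

(* Main.v *)
Require Import Defs.
From HB Require Import structures.
From mathcomp Require Import all_boot all_order all_algebra.
From mathcomp Require Import generic_quotient ring_quotient finmap zify.
From mathcomp Require Import all_classical topology.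
From mathcomp Require Import mpoly.

(** The algebra [A] of the pullback is, in effect, the Kumjian-Pask algebra of
    [G] with Laurent polynomials in [U_1, ..., U_r] as coefficients. Any choice
    of preimages of the generators of [N^l] gives a monoid section [g] of [f];
    the elements [s_(x, g (d x))], [t_(x, g (d x))] form a family for [G]
    ([section_family]), changing the second coordinate of a path is
    multiplication by a central unit, and hence the elements [U_c S_x T_y] with
    [c] in [Z^r] span [A] ([section_span]). The universal property enters
    twice: its uniqueness half shows that the products [s t] span [A]
    ([span_full]), its existence half supplies representations.

    Fix a maximal tail [M] and a point [a] of the torus, and let [I] be the
    ideal generated by the vertices outside [M] and the [U_i - a_i].

    No vertex of [M] lies in [I]: the paths of [G] act on functions on the
    infinite paths that stay in [M], and twisting this action by a character
    of [N^k] built from [a] kills [I] but no vertex of [M]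
    ([vertex_notin_tail_ideal]).

    The decisive step is [corner_compression]: if [b] is not in [I], then
    [u b w = q(U) P_v] for some [u], [w], some [v] in [M] and some Laurent
    polynomial [q] with [q(a)] nonzero. Multiplying [b] on the right by a long
    [S_x] leaves a sum of terms [q_y(U) S_y]; one [q_y] does not vanish at [a],
    and multiplying by [T_(y al)] on the left and [S_al] on the right, for a
    long segment [al] of an aperiodic path, kills every other term. As this is
    an identity in [A] and not only modulo [I], it has three uses.
    - An ideal that contains [I] and no vertex of [M] equals [I]
      ([tail_ideal_maximal]).
    - [I] is primitive: all vertices of [M] lead to a single vertex [z] of [M],
      since there are finitely many; a maximal left ideal containing the [b]
      with [b P_z] in [I] gives a simple module on which [P_z] is not zero, and
      its annihilator is [I] by the previous point ([tail_ideal_primitive]).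
    - If [b] is not in [I], then it is not in the ideal of any nearby pair: [b]
      stays outside as long as the tail contains [v] and [q] does not vanish
      ([notin_tail_ideal_open]). So the parametrisation is continuous.

    Every primitive ideal arises. On a simple module the central elements [U_i]
    act by scalars: the module has countable dimension over the uncountable
    algebraically closed field ([central_scalar]). The vertices that do not act
    by zero form a maximal tail, by simplicity, and the annihilator is the
    ideal of that tail and those scalars ([annihilator_tail_ideal]).

    The inverse of the parametrisation is continuous because [P_v] lies in the
    ideal of [(M, a)] exactly when [v] is not in [M], and [q(U)] exactly when
    [q(a) = 0]: both basic kinds of closed sets are hulls
    ([prim_of_homeomorphism]). *)

Set Implicit Arguments.
Unset Strict Implicit.
Unset Printing Implicit Defensive.

Import GRing.Theory.
Local Open Scope classical_set_scope.
Local Open Scope ring_scope.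

(** * Factoring paths of a graph *)

Section Paths.
Variables (k : nat) (G : kgraph k).
Implicit Types (x y z : kpath G) (m n : NN k).

Lemma addNI m : injective (+%R m : NN k -> NN k).
Proof.
move=> n n' /ffunP e; apply/ffunP => i; have := e i.
by rewrite !ffunE => /addnI.
Qed.

Lemma factor_uniq y z y' z' : sc y = rg z -> sc y' = rg z' -> dg y = dg y' ->
  cmp y z = cmp y' z' -> y = y' /\ z = z'.
Proof.
move=> yz yz' d e.
have dz : dg z = dg z'.
  by apply: (@addNI (dg y)); rewrite -dg_cmp// d -dg_cmp// e.
have [w [_ u]] := factorisation (dg_cmp yz).
have := u (y, z) (And4 yz erefl erefl erefl).
have := u (y', z') (And4 yz' e (esym d) (esym dz)).
by move=> -> [-> ->].
Qed.

Lemma dg0_idp x : dg x = 0 -> x = idp (rg x).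
Proof.
move=> d0.
have := @factor_uniq (idp (rg x)) x x (idp (sc x)).
by rewrite sc_idp rg_idp dg_idp cmp_idl cmp_idr d0; case.
Qed.

(** A total form of the factorisation; the default value is only reached when
    [n] is not below the degree of [x]. *)
Definition splitpath n x : kpath G * kpath G :=
  xget (x, x) [set yz | [/\ sc yz.1 = rg yz.2, x = cmp yz.1 yz.2 & dg yz.1 = n]].
Definition pre n x := (splitpath n x).1.
Definition suf n x := (splitpath n x).2.

Lemma splitpath_cmp y z : sc y = rg z -> splitpath (dg y) (cmp y z) = (y, z).
Proof.
move=> yz; rewrite /splitpath; case: xgetP => [[y' z'] _ [/= yz' e d]|].
  by have [-> ->] := factor_uniq yz yz' (esym d) e.
by move=> /(_ (y, z)); case.
Qed.

Lemma pre_cmp y z : sc y = rg z -> pre (dg y) (cmp y z) = y.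
Proof. by move=> yz; rewrite /pre splitpath_cmp. Qed.

Lemma suf_cmp y z : sc y = rg z -> suf (dg y) (cmp y z) = z.
Proof. by move=> yz; rewrite /suf splitpath_cmp. Qed.

Lemma factorP m n x : dg x = m + n ->
  [/\ sc (pre m x) = rg (suf m x), cmp (pre m x) (suf m x) = x,
      dg (pre m x) = m & dg (suf m x) = n].
Proof.
move=> /factorisation[[y z] [[/= yz e dy dz] _]].
by rewrite -dy e pre_cmp// suf_cmp// dz.
Qed.

Lemma rg_pre m n x : dg x = m + n -> rg (pre m x) = rg x.
Proof. by move=> /factorP[yz e _ _]; rewrite -{2}e rg_cmp. Qed.

Lemma sc_suf m n x : dg x = m + n -> sc (suf m x) = sc x.
Proof. by move=> /factorP[yz e _ _]; rewrite -{2}e sc_cmp. Qed.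

Lemma pre_dg x : pre (dg x) x = x.
Proof. by rewrite -{2}(cmp_idr x) pre_cmp// rg_idp. Qed.

Lemma suf0 x : suf 0 x = x.
Proof. by rewrite -{1}(cmp_idl x) -(dg_idp (rg x)) suf_cmp// sc_idp. Qed.

Lemma pre_cmpl m n y z : sc y = rg z -> dg y = m + n ->
  pre m (cmp y z) = pre m y.
Proof.
move=> yz /factorP[ab e da db].
rewrite -{1}e -{1}da -cmpA//; last by rewrite -yz -{2}e sc_cmp.
by rewrite pre_cmp// rg_cmp// -yz -{2}e sc_cmp.
Qed.

Lemma suf_cmpl m n y z : sc y = rg z -> dg y = m + n ->
  suf m (cmp y z) = cmp (suf m y) z.
Proof.
move=> yz /factorP[ab e da db].
rewrite -{1}e -{1}da -cmpA//; last by rewrite -yz -{2}e sc_cmp.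
by rewrite suf_cmp// rg_cmp// -yz -{2}e sc_cmp.
Qed.

Lemma pre_pre m n n' x : dg x = m + n + n' -> pre m (pre (m + n) x) = pre m x.
Proof.
by move=> /factorP[yz e dy dz]; rewrite -{2}e (@pre_cmpl _ n).
Qed.

Lemma suf_cmpr y z m : sc y = rg z -> (exists n, dg z = m + n) ->
  suf (dg y + m) (cmp y z) = suf m z.
Proof.
move=> yz [n /factorP[ab e da db]].
have yz1 : sc y = rg (pre m z) by rewrite yz -{1}e rg_cmp.
by rewrite -{1}e cmpA// -{1}da -dg_cmp// suf_cmp// sc_cmp.
Qed.

Lemma suf_suf m m' n x : dg x = m + m' + n -> suf m' (suf m x) = suf (m + m') x.
Proof.
move=> dx; have /factorP[yz e dy dz] : dg x = m + (m' + n) by rewrite addrA.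
by rewrite -{2}e -{2}dy suf_cmpr//; exists n.
Qed.

Lemma pre_suf m m' n x : dg x = m + m' + n ->
  pre m' (suf m x) = suf m (pre (m + m') x).
Proof.
move=> dx; have /factorP[yz e dy dz] := dx.
have [ab _ _ db] := factorP dy.
rewrite -{1}e (suf_cmpl yz dy) -{1}db pre_cmp//.
by rewrite (sc_suf dy).
Qed.

End Paths.

(** * Kumjian-Pask families in finite form *)

Section Combinations.
Variables (R : comPzRingType) (A : ualg R).

Lemma scalM_swap c d (x y : A) :
  (scal A c * x) * (scal A d * y) = scal A (c * d) * (x * y).
Proof. by rewrite rmorphM mulrA -(mulrA _ x) -scal_central !mulrA. Qed.

(** The list of scalars and indices is kept, because later its terms are
    regrouped by index. *)
Definition combo (I : Type) (F : I -> A) : set A :=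
  [set b | exists L : seq (R * I), b = \sum_(j <- L) scal A j.1 * F j.2].

Variables (I : Type) (F : I -> A).

Lemma combo_gen i : combo F (F i).
Proof. by exists [:: (1, i)]; rewrite big_seq1 rmorph1 mul1r. Qed.

Lemma combo0 : combo F 0.
Proof. by exists [::]; rewrite big_nil. Qed.

Lemma comboD a b : combo F a -> combo F b -> combo F (a + b).
Proof. by move=> [L ->] [L' ->]; exists (L ++ L'); rewrite big_cat. Qed.

Lemma comboZ c a : combo F a -> combo F (scal A c * a).
Proof.
move=> [L ->]; exists [seq (c * j.1, j.2) | j <- L].
rewrite big_map big_distrr; apply: eq_bigr => j _.
by rewrite rmorphM/= mulrA.
Qed.

Lemma comboN a : combo F a -> combo F (- a).
Proof. by move=> /(comboZ (-1)); rewrite rmorphN1 mulN1r. Qed.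

Lemma combo_sum (J : eqType) (L : seq J) (g : J -> A) :
  (forall j, j \in L -> combo F (g j)) -> combo F (\sum_(j <- L) g j).
Proof.
move=> gF; rewrite big_seq; elim/big_ind: _ => //; first exact: combo0.
exact: comboD.
Qed.

Lemma comboM a b : (forall i j, combo F (F i * F j)) ->
  combo F a -> combo F b -> combo F (a * b).
Proof.
move=> FF [L ->] [L' ->]; rewrite big_distrl /=.
elim: L => [|[c i] L IH]; first by rewrite big_nil; exact: combo0.
rewrite big_cons; apply: comboD => //; rewrite big_distrr /=.
elim: L' {IH} => [|[d j] L' IH]; first by rewrite big_nil; exact: combo0.
rewrite big_cons; apply: comboD => //=.
by rewrite scalM_swap; apply: comboZ.
Qed.

End Combinations.

Lemma big_pred1_uniq (R : nmodType) (I : eqType) (s : seq I) (i : I) (F : I -> R) :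
  uniq s -> i \in s -> \sum_(j <- s | j == i) F j = F i.
Proof. by move=> us si; rewrite -big_filter filter_pred1_uniq// big_seq1. Qed.

Lemma sum_by_fibre (R : nmodType) (I J : choiceType) (s : seq I) (vs : seq J) (h : I -> J)
   (F : I -> R) : uniq vs -> (forall i, i \in s -> h i \in vs) ->
  \sum_(i <- s) F i = \sum_(v <- vs) \sum_(i <- s | h i == v) F i.
Proof.
move=> uvs hs; under [RHS]eq_bigr do rewrite big_mkcond.
rewrite exchange_big /=; rewrite big_seq [RHS]big_seq; apply: eq_bigr => i si.
rewrite -big_mkcond; under eq_bigl do rewrite eq_sym.
by rewrite big_pred1_uniq// hs.
Qed.

Section Family.
Variables (k : nat) (G : kgraph k) (R : comPzRingType) (A : ualg R).
Variables (p : vertex G -> A) (s t : kpath G -> A).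
Hypotheses (rf : row_finite G) (fv : finite_set [set: vertex G]).
Hypothesis KP : KP_family p s t.

Lemma level_finite n : finite_set [set x : kpath G | dg x = n].
Proof.
have -> : [set x : kpath G | dg x = n] = \bigcup_(v in [set: vertex G]) out v n.
  by apply/seteqP; split=> [x xn|x [v _ []//]]; exists (rg x).
by apply: bigcup_finite => // v _; exact: rf.
Qed.

Definition level n : seq (kpath G) := fset_set [set x : kpath G | dg x = n].

Lemma mem_level n x : (x \in level n) = (dg x == n).
Proof.
by rewrite in_fset_set; [apply/asboolP/eqP | exact: level_finite].
Qed.

Lemma level_uniq n : uniq (level n). Proof. exact: fset_uniq. Qed.

Definition vertices : seq (vertex G) := fset_set [set: vertex G].

Lemma mem_vertices v : v \in vertices.
Proof. by rewrite in_fset_set// inE. Qed.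

Lemma vertices_uniq : uniq vertices. Proof. exact: fset_uniq. Qed.

Lemma out_sum (F : kpath G -> A) v n :
  \sum_(x \in out v n) F x = \sum_(x <- level n | rg x == v) F x.
Proof.
rewrite fsbig_finite//.
rewrite -[RHS]big_filter; apply: perm_big; apply: uniq_perm.
- exact: fset_uniq.
- by rewrite filter_uniq// level_uniq.
- move=> x; rewrite mem_filter mem_level in_fset_set; last exact: (rf v n).
  by apply/asboolP/andP => [[-> ->]|[/eqP xv /eqP xn]]; rewrite ?eqxx.
Qed.

Lemma level_sum (F : kpath G -> A) n :
  \sum_(v \in [set: vertex G]) \sum_(x \in out v n) F x = \sum_(x <- level n) F x.
Proof.
rewrite fsbig_finite// (@sum_by_fibre _ _ _ _ vertices (@rg _ G))//.
- by apply: eq_bigr => v _; rewrite out_sum.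
- exact: vertices_uniq.
- by move=> x _; exact: mem_vertices.
Qed.

(** In degree zero the relation is not an axiom; it holds because the identity
    is the only path of degree zero with range [v]. *)
Lemma p_level v n : p v = \sum_(x <- level n | rg x == v) s x * t x.
Proof.
have [->|n0] := eqVneq n 0; last by rewrite (kp4 KP v n0) out_sum.
rewrite -big_filter (perm_big [:: idp v]).
  by rewrite big_seq1 (kp_s_idp KP) (kp_t_idp KP) (kp1 KP) eqxx.
apply: uniq_perm => //; first by rewrite filter_uniq// level_uniq.
move=> x; rewrite mem_filter mem_level inE.
apply/andP/eqP => [[/eqP<- /eqP/dg0_idp//]|->].
by rewrite rg_idp dg_idp.
Qed.

Definition vsum : A := \sum_(v <- vertices) p v.

Lemma vsum_level n : vsum = \sum_(x <- level n) s x * t x.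
Proof.
rewrite (@sum_by_fibre _ _ _ _ vertices (@rg _ G))//.
- by apply: eq_bigr => v _; rewrite -p_level.
- exact: vertices_uniq.
- by move=> x _; exact: mem_vertices.
Qed.

Lemma vsum_p v : vsum * p v = p v.
Proof.
rewrite /vsum big_distrl /=; under eq_bigr => w _.
  rewrite (kp1 KP).
  have -> : (if w == v then p w else 0) = (if w == v then p v else 0).
    by case: eqP => [->|].
  over.
by rewrite -big_mkcond big_pred1_uniq ?vertices_uniq ?mem_vertices.
Qed.

Lemma p_vsum v : p v * vsum = p v.
Proof.
rewrite /vsum big_distrr /=; under eq_bigr => w _ do rewrite (kp1 KP) eq_sym.
by rewrite -big_mkcond big_pred1_uniq ?vertices_uniq ?mem_vertices.
Qed.

Lemma vsum_s x : vsum * s x = s x.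
Proof. by rewrite -(kp2_ps KP) mulrA vsum_p. Qed.
Lemma s_vsum x : s x * vsum = s x.
Proof. by rewrite -(kp2_sp KP) -mulrA p_vsum. Qed.
Lemma vsum_t x : vsum * t x = t x.
Proof. by rewrite -(kp2_pt KP) mulrA vsum_p. Qed.
Lemma t_vsum x : t x * vsum = t x.
Proof. by rewrite -(kp2_tp KP) -mulrA p_vsum. Qed.

Lemma ss0 x y : sc x <> rg y -> s x * s y = 0.
Proof.
move=> xy; rewrite -(kp2_sp KP) -(kp2_ps KP y) -mulrA (mulrA (p _)) (kp1 KP).
by case: eqP => // _; rewrite mul0r mulr0.
Qed.

Lemma tt0 x y : sc y <> rg x -> t x * t y = 0.
Proof.
move=> xy; rewrite -(kp2_tp KP) -(kp2_pt KP y) -mulrA (mulrA (p _)) (kp1 KP).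
by case: eqP => [e|]; [case: xy | rewrite mul0r mulr0].
Qed.

Lemma st0 x y : sc x <> sc y -> s x * t y = 0.
Proof.
move=> xy; rewrite -(kp2_sp KP) -(kp2_pt KP y) -mulrA (mulrA (p _)) (kp1 KP).
by case: eqP => // _; rewrite mul0r mulr0.
Qed.

Lemma ts_long x y n : dg y = dg x + n ->
  t x * s y = if pre (dg x) y == x then s (suf (dg x) y) else 0.
Proof.
move=> /factorP[ab e da db]; rewrite -{1}e -(kp2_s KP)// mulrA (kp3 KP)//.
rewrite eq_sym; case: eqP => [ex|]; last by rewrite mul0r.
by rewrite -{1}ex ab (kp2_ps KP).
Qed.

(** Inserting the sum of all [s_z t_z] with [d z = d x] behind [y] makes the
    path long enough for a prefix to be compared with [x]. *)
Lemma ts_expand x y : t x * s y =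
  \sum_(z <- level (dg x) | sc y == rg z)
    (if pre (dg x) (cmp y z) == x then s (suf (dg x) (cmp y z)) * t z else 0).
Proof.
rewrite -(s_vsum y) (vsum_level (dg x)) mulrA big_distrr /= [RHS]big_mkcond.
rewrite big_seq [RHS]big_seq; apply: eq_bigr => z; rewrite mem_level => /eqP dz.
case: eqP => [yz|yz]; last by rewrite -mulrA (mulrA (s y)) ss0// mul0r mulr0.
rewrite -mulrA (mulrA (s y)) (kp2_s KP)// mulrA (@ts_long _ _ (dg y)).
  by case: ifP; rewrite ?mul0r.
by rewrite dg_cmp// dz addrC.
Qed.

Lemma stst_combo xy xy' :
  combo (fun xy => s xy.1 * t xy.2) (s xy.1 * t xy.2 * (s xy'.1 * t xy'.2)).
Proof.
case: xy xy' => [x y] [x' y'] /=.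
rewrite mulrA -(mulrA (s x)) ts_expand big_distrr big_distrl /= big_mkcond.
apply: combo_sum => z _; case: ifP => [yz|_]; last exact: combo0.
case: ifP => _; last by rewrite mulr0 mul0r; exact: combo0.
rewrite mulrA -mulrA.
have [e|e] := pselect (sc x = rg (suf (dg y) (cmp x' z))); last first.
  by rewrite ss0// mul0r; exact: combo0.
have [e'|e'] := pselect (sc y' = rg z); last first.
  by rewrite tt0// mulr0; exact: combo0.
rewrite (kp2_s KP)// (kp2_t KP)//.
exact: (combo_gen (fun xy => s xy.1 * t xy.2) (_, _)).
Qed.

End Family.

(** * The universal algebra is spanned by the products s t *)

Section Subalgebra.
Variables (R : comPzRingType) (A : ualg R).

(** All scalars are included, so that the type of elements is a unital algebra,
    to which the universal property applies. *)
Record subalgebra := Subalgebra {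
  subalg_set :> A -> Prop;
  subalg_scal : forall c, subalg_set (scal A c);
  subalg_sub : forall a b, subalg_set a -> subalg_set b -> subalg_set (a - b);
  subalg_mul : forall a b, subalg_set a -> subalg_set b -> subalg_set (a * b)
}.

Variable C : subalgebra.

Definition subalg_pred : {pred A} := fun b => `[< C b >].

Lemma subalg_pred_closed : subring_closed subalg_pred.
Proof.
split.
- by apply/asboolP; rewrite -(rmorph1 (scal A)); exact: subalg_scal.
- by move=> a b /asboolP Ca /asboolP Cb; apply/asboolP; exact: subalg_sub.
- by move=> a b /asboolP Ca /asboolP Cb; apply/asboolP; exact: subalg_mul.
Qed.

Record subalg_sort := SubalgElt {
  subalg_val : A; _ : subalg_val \in subalg_pred }.
HB.instance Definition _ := [isSub for subalg_val].
HB.instance Definition _ := [Choice of subalg_sort by <:].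
HB.instance Definition _ :=
  GRing.SubChoice_isSubPzRing.Build A subalg_pred subalg_sort subalg_pred_closed.

Definition subalg_elt (a : A) (Ca : C a) : subalg_sort := SubalgElt (asboolT Ca).

Definition subalg_scalar (c : R) : subalg_sort := subalg_elt (subalg_scal C c).

Lemma subalg_scalar_additive : zmod_morphism subalg_scalar.
Proof. by move=> c d; apply: val_inj; rewrite /= rmorphB. Qed.
Lemma subalg_scalar_mul : monoid_morphism subalg_scalar.
Proof. by split=> [|c d]; apply: val_inj; rewrite /= ?rmorph1// rmorphM. Qed.
HB.instance Definition _ := GRing.isZmodMorphism.Build R subalg_sort
  subalg_scalar subalg_scalar_additive.
HB.instance Definition _ := GRing.isMonoidMorphism.Build R subalg_sort
  subalg_scalar subalg_scalar_mul.

Lemma subalg_scalar_central (c : R) (g : subalg_sort) :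
  (subalg_scalar c : subalg_sort) * g = g * subalg_scalar c.
Proof. by apply: val_inj; rewrite /= scal_central. Qed.

Definition subalg_alg : ualg R := @UAlg R subalg_sort subalg_scalar subalg_scalar_central.

Lemma subalg_valP (g : subalg_sort) : C (val g).
Proof. by apply/asboolP; exact: (valP g). Qed.

End Subalgebra.

Section Universal.
Variables (k : nat) (G : kgraph k) (R : comPzRingType) (A : ualg R).
Variables (p : vertex G -> A) (s t : kpath G -> A).
Hypotheses (rf : row_finite G) (fv : finite_set [set: vertex G]).
Hypothesis KP : is_KP p s t.

Local Notation C := (combo (fun xy : kpath G * kpath G => s xy.1 * t xy.2)).

(** The uniqueness half of the universal property, from which both the spanning
    statement and the identification of the unit follow. *)
Lemma endomorphism_id (phi : A -> A) : alg_hom phi ->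
  (forall v, phi (p v) = p v) -> (forall x, phi (s x) = s x) ->
  (forall x, phi (t x) = t x) -> forall a, phi a = a.
Proof.
move=> hphi P S T a; have [F U] := KP; have [chi [_ u]] := U A p s t F.
have <- : chi = phi by apply: u; split.
by have -> : chi = id by apply: u; split.
Qed.

Let F : KP_family p s t := proj1 KP.

Lemma combo_p v : C (p v).
Proof.
have := combo_gen (fun xy : kpath G * kpath G => s xy.1 * t xy.2) (idp v, idp v).
by rewrite /= (kp_s_idp F) (kp_t_idp F) (kp1 F) eqxx.
Qed.
Lemma combo_s x : C (s x).
Proof.
have := combo_gen (fun xy : kpath G * kpath G => s xy.1 * t xy.2) (x, idp (sc x)).
by rewrite /= (kp_t_idp F) (kp2_sp F).
Qed.
Lemma combo_t x : C (t x).
Proof.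
have := combo_gen (fun xy : kpath G * kpath G => s xy.1 * t xy.2) (idp (sc x), x).
by rewrite /= (kp_s_idp F) (kp2_pt F).
Qed.

Definition unital_span (b : A) : Prop := exists2 a, C a & exists c, b = a + scal A c.

Lemma unital_spanW a : C a -> unital_span a.
Proof. by move=> Ca; exists a => //; exists 0; rewrite rmorph0 addr0. Qed.

Lemma unital_span_scal c : unital_span (scal A c).
Proof. by exists 0; [exact: combo0|exists c; rewrite add0r]. Qed.

Lemma unital_span_sub a b :
  unital_span a -> unital_span b -> unital_span (a - b).
Proof.
move=> [a' Ca [c ->]] [b' Cb [d ->]]; exists (a' - b').
  by apply: comboD => //; exact: comboN.
by exists (c - d); rewrite rmorphB opprD addrACA.
Qed.

Lemma unital_span_mul a b :
  unital_span a -> unital_span b -> unital_span (a * b).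
Proof.
move=> [a' Ca [c ->]] [b' Cb [d ->]].
exists (a' * b' + scal A c * b' + scal A d * a').
  apply: comboD; [apply: comboD|]; [|exact: comboZ..].
  by apply: comboM => // ? ?; exact: stst_combo F _ _.
exists (c * d); rewrite mulrDl !mulrDr rmorphM -(scal_central d a').
by rewrite -!addrA; congr (_ + _); rewrite addrCA.
Qed.

Definition unital_subalgebra : subalgebra A :=
  Subalgebra unital_span_scal unital_span_sub unital_span_mul.

(** The universal property maps [A] to the subalgebra generated by the scalars
    and the generators; followed by the inclusion this fixes the generators, so
    it is the identity. *)
Lemma unital_span_full a : unital_span a.
Proof.
pose B := subalg_alg unital_subalgebra.
pose q v : B := subalg_elt (C := unital_subalgebra) (unital_spanW (combo_p v)).
pose u v : B := subalg_elt (C := unital_subalgebra) (unital_spanW (combo_s v)).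
pose w v : B := subalg_elt (C := unital_subalgebra) (unital_spanW (combo_t v)).
have FB : KP_family q u w.
  split.
  - by move=> v; apply: val_inj; exact: kp_s_idp F v.
  - by move=> v; apply: val_inj; exact: kp_t_idp F v.
  - by move=> v v'; apply: val_inj => /=; rewrite (kp1 F) (fun_if val).
  - by move=> x y e; apply: val_inj; exact: kp2_s F _ _ e.
  - by move=> x y e; apply: val_inj; exact: kp2_t F _ _ e.
  - by move=> x; apply: val_inj; exact: kp2_ps F x.
  - by move=> x; apply: val_inj; exact: kp2_sp F x.
  - by move=> x; apply: val_inj; exact: kp2_pt F x.
  - by move=> x; apply: val_inj; exact: kp2_tp F x.
  - by move=> x y e; apply: val_inj => /=; rewrite (kp3 F)// (fun_if val).
  - move=> v n n0; apply: val_inj; rewrite /= (kp4 F v n0) !fsbig_finite//.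
    by rewrite -[RHS]/(val _) raddf_sum.
have [phi [[[phiD phiM phiZ] P S T] _]] := (proj2 KP) B q u w FB.
have <- : val (phi a) = a.
  apply: (@endomorphism_id (fun a => val (phi a))).
  - split=> [x y|x y|c x]; first by rewrite phiD.
      by rewrite phiM.
    by rewrite phiZ.
  - by move=> v; rewrite P.
  - by move=> v; rewrite S.
  - by move=> v; rewrite T.
exact: (@subalg_valP _ _ unital_subalgebra (phi a)).
Qed.

(** The sum of the vertices is a unit for the span of the products [s t], hence
    central in [A] by [unital_span_full]. Multiplication by it is therefore an
    endomorphism, and it fixes the generators. *)
Lemma vsum1 : vsum p = 1.
Proof.
have eC a : C a -> vsum p * a = a /\ a * vsum p = a.
  move=> [L ->]; rewrite big_distrr big_distrl /=; split; apply: eq_bigr => j _.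
    by rewrite mulrA -scal_central -mulrA (mulrA (vsum p)) (vsum_s fv F).
  by rewrite -mulrA -mulrA (t_vsum fv F).
have e1 a : vsum p * a = a * vsum p.
  have [b Cb [c ->]] := unital_span_full a.
  rewrite mulrDr mulrDl; have [-> ->] := eC _ Cb; by rewrite scal_central.
have ee : vsum p * vsum p = vsum p.
  rewrite {2}/vsum big_distrr /=; apply: eq_bigr => v _; exact: (vsum_p fv F).
rewrite -[LHS]mulr1; apply: (@endomorphism_id (fun a => vsum p * a)).
- split=> [x y|x y|c x]; first by rewrite mulrDr.
    by rewrite [RHS]mulrA -(mulrA _ x) -(e1 x) !mulrA ee.
  by rewrite mulrA -scal_central mulrA.
- by move=> v; rewrite (vsum_p fv F).
- by move=> v; rewrite (vsum_s fv F).
- by move=> v; rewrite (vsum_t fv F).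
Qed.

Lemma span_full a : C a.
Proof.
have [b Cb [c ->]] := unital_span_full a; apply: comboD => //.
rewrite -[scal A c]mulr1; apply: comboZ; rewrite -vsum1.
by apply: combo_sum => v _; exact: combo_p.
Qed.

End Universal.

(** * Algebras of linear endomorphisms *)

Section Endomorphisms.
Variables (R : comPzRingType) (V : lmodType R).

Definition endo_pred : {pred V -> V} := fun g => `[< linear g >].

Lemma endo_zmod_closed : zmod_closed endo_pred.
Proof.
split; first by apply/asboolP => c x y; rewrite scaler0 addr0.
move=> g g' /asboolP Hg /asboolP Hg'; apply/asboolP => c x y.
rewrite !fctE Hg Hg' scalerBr opprD.
by rewrite addrACA.
Qed.
HB.instance Definition _ := GRing.isZmodClosed.Build (V -> V) endo_pred endo_zmod_closed.

Record endo := Endo { endo_fun :> V -> V; _ : endo_fun \in endo_pred }.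
HB.instance Definition _ := [isSub for endo_fun].
HB.instance Definition _ := [Choice of endo by <:].
HB.instance Definition _ := [SubChoice_isSubZmodule of endo by <:].

Lemma endoP (g : endo) : linear g.
Proof. by apply/asboolP; exact: (valP g). Qed.

Lemma endo_ext (g g' : endo) : (forall x, g x = g' x) -> g = g'.
Proof. by move=> e; apply: val_inj; apply/funext. Qed.

Definition mk_endo (g : V -> V) (Hg : linear g) : endo := Endo (asboolT Hg).

Lemma endo_one_linear : linear (fun x : V => x). Proof. by []. Qed.
Lemma endo_mul_linear (g g' : endo) : linear (fun x : V => g (g' x)).
Proof. by move=> c x y; rewrite !endoP. Qed.
Lemma endo_scal_linear (c : R) : linear (fun x : V => c *: x).
Proof. by move=> d x y; rewrite scalerDr !scalerA mulrC. Qed.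

Definition endo_one := mk_endo endo_one_linear.
Definition endo_mul g g' := mk_endo (@endo_mul_linear g g').
Definition endo_scal c := mk_endo (endo_scal_linear c).

Lemma endoD (g : endo) x y : g (x + y) = g x + g y.
Proof. by have := endoP g 1 x y; rewrite !scale1r. Qed.
Lemma endo0 (g : endo) : g 0 = 0.
Proof. by have := endoP g (-1) 0 0; rewrite scaler0 addr0 scaleN1r addNr. Qed.
Lemma endoZ (g : endo) c x : g (c *: x) = c *: g x.
Proof. by have := endoP g c x 0; rewrite !addr0 endo0 addr0. Qed.

Lemma endo_mulA : associative endo_mul. Proof. by move=> g g' g''; apply: endo_ext. Qed.
Lemma endo_mul1 : left_id endo_one endo_mul. Proof. by move=> g; apply: endo_ext. Qed.
Lemma endo_mulr1 : right_id endo_one endo_mul. Proof. by move=> g; apply: endo_ext. Qed.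
Lemma endo_mulDl : left_distributive endo_mul +%R.
Proof. by move=> g g' g''; apply: endo_ext. Qed.
Lemma endo_mulDr : right_distributive endo_mul +%R.
Proof. by move=> g g' g''; apply: endo_ext => x; exact: endoD. Qed.
HB.instance Definition _ := GRing.Zmodule_isPzRing.Build endo
  endo_mulA endo_mul1 endo_mulr1 endo_mulDl endo_mulDr.

Lemma endo_scal_additive : zmod_morphism endo_scal.
Proof. by move=> c d; apply: endo_ext => x; rewrite /= scalerBl. Qed.
Lemma endo_scal_mul : monoid_morphism endo_scal.
Proof.
by split=> [|c d]; apply: endo_ext => x; rewrite /= ?scale1r// -scalerA.
Qed.
HB.instance Definition _ := GRing.isZmodMorphism.Build R endo endo_scal endo_scal_additive.
HB.instance Definition _ := GRing.isMonoidMorphism.Build R endo endo_scal endo_scal_mul.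

Lemma endo_scal_central (c : R) (g : endo) : (endo_scal c : endo) * g = g * endo_scal c.
Proof. by apply: endo_ext => x; rewrite /= endoZ. Qed.

Definition endo_alg : ualg R := @UAlg R endo endo_scal endo_scal_central.

End Endomorphisms.

(** * Infinite paths through a set of vertices *)

Section BoundaryPaths.
Variables (l : nat) (G : kgraph l) (T : set (vertex G)).
Hypothesis T1 : forall v w, T w -> linked v w -> T v.
Implicit Types (x : kpath G) (m n : NN l).

(** An infinite path is encoded by its initial segments of every degree, so that
    equality is equality of segments; [T] is the set of vertices it may visit. *)
Record bpath := BPath {
  bp :> NN l -> kpath G;
  bp_dg : forall n, dg (bp n) = n;
  bp_T : forall n, T (sc (bp n));
  bp_pre : forall m n, pre m (bp (m + n)) = bp m
}.
Implicit Type y : bpath.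

Lemma bpath_ext y y' : (forall n, y n = y' n) -> y = y'.
Proof.
case: y y' => y a b c [y' a' b' c'] /= /funext e; move: a b c a' b' c'.
by rewrite e => *; congr BPath; exact: Prop_irrelevance.
Qed.

Definition brg y : vertex G := rg (y 0).

Lemma bp_rg y n : rg (y n) = brg y.
Proof.
by rewrite /brg -(bp_pre y 0 n) add0r (@rg_pre _ _ 0 n)// add0r bp_dg.
Qed.

Lemma bp_split y m n : sc (y m) = rg (suf m (y (m + n))) /\
  cmp (y m) (suf m (y (m + n))) = y (m + n).
Proof.
by have [] := factorP (bp_dg y (m + n)); rewrite bp_pre.
Qed.

Lemma bshift_dg y m n : dg (suf m (y (m + n))) = n.
Proof. by have [] := factorP (bp_dg y (m + n)). Qed.
Lemma bshift_T y m n : T (sc (suf m (y (m + n)))).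
Proof. by rewrite (sc_suf (bp_dg y (m + n))); apply: bp_T. Qed.
Lemma bshift_pre y m n n' :
  pre n (suf m (y (m + (n + n')))) = suf m (y (m + n)).
Proof. by rewrite (@pre_suf _ _ _ _ n') ?bp_dg ?addrA// bp_pre. Qed.

Definition bshift m y : bpath :=
  BPath (bshift_dg y m) (bshift_T y m) (bshift_pre y m).

Lemma brg_shift y m : brg (bshift m y) = sc (y m).
Proof. by rewrite /brg /=; case: (bp_split y m 0) => ->. Qed.

Lemma bshiftD y m n : bshift m (bshift n y) = bshift (n + m) y.
Proof.
apply: bpath_ext => j /=.
by rewrite (@suf_suf _ _ _ _ j) ?bp_dg ?addrA.
Qed.

Section Concat.
Variables (x : kpath G) (y : bpath).
Hypothesis xy : sc x = brg y.

Let dxy n : dg (cmp x (y n)) = n + dg x.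
Proof. by rewrite dg_cmp ?bp_rg// bp_dg addrC. Qed.

Lemma bconcat_dg n : dg (pre n (cmp x (y n))) = n.
Proof. by case: (factorP (dxy n)). Qed.
Lemma bconcat_T n : T (sc (pre n (cmp x (y n)))).
Proof.
have [ab e da db] := factorP (dxy n).
apply: (@T1 _ (sc (y n))); first exact: bp_T.
exists (suf n (cmp x (y n))); split=> //.
by rewrite (sc_suf (dxy n)) sc_cmp ?bp_rg.
Qed.

Lemma bconcat_far m n : pre m (cmp x (y (m + n))) = pre m (cmp x (y m)).
Proof.
have [ab <-] := bp_split y m n; rewrite cmpA ?bp_rg//.
by rewrite (@pre_cmpl _ _ _ (dg x)) ?sc_cmp ?bp_rg.
Qed.
Lemma bconcat_pre m n :
  pre m (pre (m + n) (cmp x (y (m + n)))) = pre m (cmp x (y m)).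
Proof. by rewrite (@pre_pre _ _ m n (dg x)) ?dxy// bconcat_far. Qed.

(** The product of [x] with the segment of degree [n] of [y] has degree at least
    [n], so the segment of degree [n] of the concatenation can be read off it. *)
Definition bconcat : bpath := BPath bconcat_dg bconcat_T bconcat_pre.

Lemma brg_concat : brg bconcat = rg x.
Proof. by rewrite /brg /= (rg_pre (dxy 0)) rg_cmp ?bp_rg. Qed.

Lemma bconcat_at : bconcat (dg x) = x.
Proof. by rewrite /= pre_cmp ?bp_rg. Qed.

Lemma bconcatD n : bconcat (dg x + n) = cmp x (y n).
Proof.
have [ab e] := bp_split y n (dg x).
rewrite /= [in y _]addrC -e cmpA ?bp_rg//.
rewrite -{1}(bp_dg y n) -dg_cmp ?bp_rg// pre_cmp//.
by rewrite sc_cmp ?bp_rg.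
Qed.

Lemma bshift_concat : bshift (dg x) bconcat = y.
Proof.
apply: bpath_ext => n; change (suf (dg x) (bconcat (dg x + n)) = y n).
by rewrite bconcatD suf_cmp ?bp_rg.
Qed.

End Concat.

Lemma bconcat_shift x y (e : y (dg x) = x) (xy : sc x = brg (bshift (dg x) y)) :
  bconcat xy = y.
Proof.
apply: bpath_ext => n /=.
have [_] := bp_split y (dg x) n; rewrite {1}e => ->.
by rewrite addrC bp_pre.
Qed.

Lemma bconcatA x x' y (xy' : sc x' = brg y) (xx' : sc x = brg (bconcat xy'))
  (xxy : sc (cmp x x') = brg y) : bconcat xx' = bconcat xxy.
Proof.
have e : sc x = rg x' by rewrite xx' brg_concat.
apply: bpath_ext => n.
have -> : bconcat xx' n = pre n (bconcat xx' (dg x + (dg x' + n))).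
  by rewrite addrA addrC bp_pre.
have -> : bconcat xxy n = pre n (bconcat xxy (dg (cmp x x') + n)).
  by rewrite addrC bp_pre.
by rewrite !bconcatD cmpA ?bp_rg.
Qed.

End BoundaryPaths.

(** * The twisted infinite path representation *)

(** All functions are taken, not only those of finite support: the three kinds
    of operators are substitutions, so they make sense and no basis is needed. *)
Definition path_functions (K : fieldType) l (G : kgraph l) (T : set (vertex G)) :
  lmodType K := [the lmodType K of bpath T -> K^o].

Section BoundaryOperators.
Variables (K : fieldType) (l : nat) (G : kgraph l) (T : set (vertex G)).
Hypothesis T1 : forall v w, T w -> linked v w -> T v.
Local Notation X := (bpath T).
Local Notation V := (path_functions K T).
Local Notation E := (endo V).
Implicit Types (x : kpath G) (y : X) (g : V).

Definition bpath_cons x y : X :=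
  if pselect (sc x = brg y) is left e then bconcat T1 e else y.

Lemma bpath_consE x y (e : sc x = brg y) : bpath_cons x y = bconcat T1 e.
Proof.
rewrite /bpath_cons; case: pselect => // e'.
by rewrite (Prop_irrelevance e e').
Qed.

Definition fun_p v g : V := fun y => if brg y == v then g y else 0.
Definition fun_s x g : V := fun y => if y (dg x) == x then g (bshift (dg x) y) else 0.
Definition fun_t x g : V := fun y => if brg y == sc x then g (bpath_cons x y) else 0.

Lemma fun_p_linear v : linear (fun_p v).
Proof.
move=> c g g'; apply/funext => y; rewrite /fun_p !fctE.
by case: ifP => // _; rewrite scaler0 addr0.
Qed.
Lemma fun_s_linear v : linear (fun_s v).
Proof.
move=> c g g'; apply/funext => y; rewrite /fun_s !fctE.
by case: ifP => // _; rewrite scaler0 addr0.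
Qed.
Lemma fun_t_linear v : linear (fun_t v).
Proof.
move=> c g g'; apply/funext => y; rewrite /fun_t !fctE.
by case: ifP => // _; rewrite scaler0 addr0.
Qed.

Definition op_p v : E := mk_endo (fun_p_linear v).
Definition op_s x : E := mk_endo (fun_s_linear x).
Definition op_t x : E := mk_endo (fun_t_linear x).

Lemma endo_fun_ext (e e' : E) : (forall g y, e g y = e' g y) -> e = e'.
Proof. by move=> ee; apply: endo_ext => g; apply/funext => y. Qed.

Lemma op_pM v w : op_p v * op_p w = if v == w then op_p v else 0.
Proof.
case: ifP => [/eqP<-|vw]; apply: endo_fun_ext => g y /=; rewrite /fun_p.
  by case: (brg y == v).
by case: ifP => [/eqP->|//]; rewrite vw.
Qed.

Lemma op_ps x : op_p (rg x) * op_s x = op_s x.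
Proof.
apply: endo_fun_ext => g y /=; rewrite /fun_p /fun_s.
case: (eqVneq (y (dg x)) x) => [e|]; last by case: ifP.
by rewrite -{1}e bp_rg eqxx.
Qed.

Lemma op_sp x : op_s x * op_p (sc x) = op_s x.
Proof.
apply: endo_fun_ext => g y /=; rewrite /fun_p /fun_s.
by case: (eqVneq (y (dg x)) x) => [e|//]; rewrite brg_shift e eqxx.
Qed.

Lemma op_pt x : op_p (sc x) * op_t x = op_t x.
Proof. by apply: endo_fun_ext => g y /=; rewrite /fun_p /fun_t; case: (brg y == _). Qed.

Lemma op_tp x : op_t x * op_p (rg x) = op_t x.
Proof.
apply: endo_fun_ext => g y /=; rewrite /fun_p /fun_t.
case: eqP => // e; rewrite (bpath_consE (esym e)).
by rewrite brg_concat eqxx.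
Qed.

Lemma op_sM x x' : sc x = rg x' -> op_s x * op_s x' = op_s (cmp x x').
Proof.
move=> xx'; apply: endo_fun_ext => g y /=; rewrite /fun_s /= dg_cmp// bshiftD.
have [ab e] := bp_split y (dg x) (dg x').
case: (eqVneq (y (dg x)) x) => [yx|yx].
  have -> : (suf (dg x) (y (dg x + dg x')) == x') = (y (dg x + dg x') == cmp x x').
    apply/eqP/eqP => [e'|->]; first by rewrite -e yx e'.
    by rewrite suf_cmp.
  by [].
case: eqP => // e'.
by rewrite -(bp_pre y _ (dg x')) e' pre_cmp ?eqxx in yx.
Qed.

Lemma op_tM x x' : sc x = rg x' -> op_t x' * op_t x = op_t (cmp x x').
Proof.
move=> xx'; apply: endo_fun_ext => g y /=; rewrite /fun_t /= sc_cmp//.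
case: eqP => // e; rewrite (bpath_consE (esym e)) brg_concat -xx' eqxx.
have e1 : sc x = brg (bconcat T1 (esym e)) by rewrite brg_concat.
have e2 : sc (cmp x x') = brg y by rewrite sc_cmp.
by rewrite (bpath_consE e1) (bpath_consE e2) (bconcatA e1 e2).
Qed.

Lemma op_ts x x' : dg x = dg x' ->
  op_t x * op_s x' = if x == x' then op_p (sc x) else 0.
Proof.
move=> d; transitivity (if x == x' then op_p (sc x) else 0 : E); last by [].
case: ifP => [/eqP<-|xx'];
  apply: endo_fun_ext => g y /=; rewrite /fun_p /fun_t /fun_s;
  case: eqP => // e; rewrite (bpath_consE (esym e)).
  by rewrite bconcat_at eqxx bshift_concat.
by rewrite -d bconcat_at xx'.
Qed.

Lemma op_stE x g y : (op_s x * op_t x : E) g y = if y (dg x) == x then g y else 0.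
Proof.
rewrite /= /fun_s /fun_t; case: eqP => // e.
rewrite brg_shift e eqxx.
have e' : sc x = brg (bshift (dg x) y) by rewrite brg_shift e.
by rewrite (bpath_consE e') bconcat_shift.
Qed.

End BoundaryOperators.

Section TwistedFamily.
Variables (K : fieldType) (k l : nat) (f : {additive NN k -> NN l}).
Variables (G : kgraph l) (T : set (vertex G)).
Hypothesis T1 : forall v w, T w -> linked v w -> T v.
Hypothesis rf : row_finite G.
Variable chi : NN k -> K.
Hypothesis chi_neq0 : forall n, chi n != 0.
Hypothesis chi0 : chi 0 = 1.
Hypothesis chiD : forall m n, chi (m + n) = chi m * chi n.
Local Notation E := (endo_alg (path_functions K T)).

Definition twisted_p (v : vertex (pullback f G)) : E := op_p K T v.
(** The factor [chi n] is what makes the central unit of [h] act by the value of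
    the character at [h]; it cancels against the factor of [twisted_t] in the
    relations that involve a product of an [s] and a [t]. *)
Definition twisted_s (z : kpath (pullback f G)) : E :=
  scal E (chi (val z).2) * op_s K T (val z).1.
Definition twisted_t (z : kpath (pullback f G)) : E :=
  scal E (chi (val z).2)^-1 * op_t K T1 (val z).1.

Lemma pullback_out_finite v n : finite_set (@out _ (pullback f G) v n).
Proof.
have fin : finite_set ((fun x => (x, n)) @` @out _ G v (f n)).
  by apply: finite_image; exact: rf.
have inj : {in @sval _ _ @^-1` ((fun x => (x, n)) @` @out _ G v (f n)) &,
    injective (@sval _ (fun z : kpath G * NN k => dg z.1 == f z.2))}.
  by move=> a b _ _; exact: val_inj.
apply: sub_finite_set (finite_preimage inj fin).
move=> z [/= dz rz]; exists (val z).1; last by rewrite -dz -surjective_pairing.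
by split=> //; rewrite -dz; apply/eqP; exact: (valP z).
Qed.

Lemma endo_sum_fun (I : Type) (L : seq I) (F : I -> E) (g : path_functions K T) y :
  (\sum_(i <- L) F i : endo _) g y = \sum_(i <- L) (F i : endo _) g y.
Proof. by elim/big_rec2: _ => // i a b _ <-. Qed.

Lemma twisted_family : KP_family twisted_p twisted_s twisted_t.
Proof.
split.
- move=> v; rewrite /twisted_s /= chi0 rmorph1 mul1r.
  apply: endo_fun_ext => g y; rewrite /= /fun_s /fun_p dg_idp.
  rewrite [y 0]dg0_idp ?bp_dg// -/(brg y).
  have -> : bshift 0 y = y.
    by apply: bpath_ext => n /=; rewrite add0r suf0.
  by rewrite -(inj_eq (can_inj (@rg_idp _ G))).
- move=> v; rewrite /twisted_t /= chi0 invr1 rmorph1 mul1r.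
  apply: endo_fun_ext => g y; rewrite /= /fun_t /fun_p sc_idp.
  case: eqP => // e.
  have e' : sc (idp v) = brg y by rewrite sc_idp.
  rewrite (bpath_consE T1 e'); congr (g _); apply: bpath_ext => n /=.
  by rewrite -e -(bp_rg y n) cmp_idl -{1}(bp_dg y n) pre_dg.
- by move=> v w; exact: op_pM.
- move=> x y e; rewrite /twisted_s scalM_swap -chiD op_sM//.
  by rewrite /= pb_cmpE.
- move=> x y e; rewrite /twisted_t scalM_swap -invfM mulrC -chiD op_tM//.
  by rewrite /= pb_cmpE.
- by move=> x; rewrite /twisted_p /twisted_s mulrA -scal_central -mulrA op_ps.
- by move=> x; rewrite /twisted_p /twisted_s -mulrA op_sp.
- by move=> x; rewrite /twisted_p /twisted_t mulrA -scal_central -mulrA op_pt.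
- by move=> x; rewrite /twisted_p /twisted_t -mulrA op_tp.
- move=> x y xy; rewrite /twisted_t /twisted_s scalM_swap -[(val y).2]xy mulVf// rmorph1 mul1r.
  rewrite op_ts; last first.
    by rewrite (eqP (valP x)) (eqP (valP y)) [_.2]xy.
  rewrite -[x == y]val_eqE [val x]surjective_pairing [val y]surjective_pairing.
  by rewrite xpair_eqE /= [X in _ && X](introT eqP xy) andbT.
- move=> v n _; rewrite fsbig_finite; last exact: pullback_out_finite.
  apply: endo_fun_ext => g y; rewrite endo_sum_fun.
  under eq_bigr => z _.
    rewrite scalM_swap mulfV// rmorph1 mul1r op_stE; over.
  rewrite -big_mkcond -big_filter.
  have ydg : dg (y (f n), n).1 == f (y (f n), n).2 by rewrite /= bp_dg.
  pose z0 : kpath (pullback f G) := exist _ (y (f n), n) ydg.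
  set L := [seq _ <- _ | _].
  have uL : uniq L by rewrite filter_uniq// fset_uniq.
  have mL z : (z \in L) = (brg y == v) && (z == z0).
    rewrite mem_filter in_fset_set; last exact: pullback_out_finite.
    apply/andP/andP => [[/eqP yz /set_mem[/= dz rz]]|[/eqP yv /eqP->]].
      split; first by rewrite -rz /pb_rg -yz bp_rg.
      have dz' : (val z).2 = n := dz.
      rewrite -val_eqE [val z]surjective_pairing dz' /=.
      by rewrite -dz' -(eqP (valP z)) yz.
    rewrite /= bp_dg eqxx; split=> //; apply/mem_set; split=> //.
    by rewrite /= /pb_rg /= bp_rg.
  rewrite /= /fun_p; case: ifP mL => [_|_] mL.
    rewrite (perm_big [:: z0]) /= ?big_seq1//.
    by apply: uniq_perm => // z; rewrite mL inE.
  by case: (L) mL => [_|z L' /(_ z)]; rewrite ?big_nil// inE eqxx.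
Qed.

End TwistedFamily.

(** * The central units of the algebra of a pullback *)

Section PullbackFamily.
Variables (k l : nat) (f : {additive NN k -> NN l}) (G : kgraph l).
Variables (K : fieldType) (A : ualg K).
Variables (p : vertex (pullback f G) -> A) (s t : kpath (pullback f G) -> A).
Hypotheses (rf : row_finite G) (fv : finite_set [set: vertex G]).
Hypothesis rfp : row_finite (pullback f G).
Hypothesis KP : KP_family p s t.
Hypothesis p1 : vsum p = 1.

Implicit Types (x y : kpath G) (m n : NN k).
Local Notation PB := (pullback f G).
Local Notation S := (gen_at s).
Local Notation T := (gen_at t).
Local Notation P := (p : vertex G -> A).

Lemma gen_atE (u : kpath PB -> A) x n (e : dg x == f n) :
  gen_at u x n = u (exist _ (x, n) e).
Proof. by rewrite /gen_at (insubT (fun z => dg z.1 == f z.2)). Qed.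

Lemma gen_at_val (u : kpath PB -> A) (z : kpath PB) :
  u z = gen_at u (val z).1 (val z).2.
Proof. by case: z => -[x n] e; rewrite (gen_atE _ e). Qed.

Lemma gen_at0 (u : kpath PB -> A) x n : dg x <> f n -> gen_at u x n = 0.
Proof.
move=> /eqP/negbTE e; rewrite /gen_at; case: insubP => //= z.
by rewrite e.
Qed.

Lemma gen_at_cmp (u : kpath PB -> A) x y n m : sc x = rg y ->
  dg x = f n -> dg y = f m ->
  forall (xn : dg x == f n) (ym : dg y == f m),
  u (pb_cmp (exist _ (x, n) xn : kpath PB) (exist _ (y, m) ym : kpath PB)) =
  gen_at u (cmp x y) (n + m).
Proof.
move=> xy dx dy xn ym; rewrite gen_at_val pb_cmpE//.
Qed.

Lemma lift_sM x y n m : sc x = rg y -> dg x = f n -> dg y = f m ->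
  S x n * S y m = S (cmp x y) (n + m).
Proof.
move=> xy dx dy; rewrite (gen_atE s (introT eqP dx)) (gen_atE s (introT eqP dy)).
by rewrite (kp2_s KP)// [cmp _ _]/= gen_at_cmp.
Qed.

Lemma lift_tM x y n m : sc x = rg y -> dg x = f n -> dg y = f m ->
  T y m * T x n = T (cmp x y) (n + m).
Proof.
move=> xy dx dy; rewrite (gen_atE t (introT eqP dx)) (gen_atE t (introT eqP dy)).
by rewrite (kp2_t KP)// [cmp _ _]/= gen_at_cmp.
Qed.

Lemma lift_ps x n : P (rg x) * S x n = S x n.
Proof.
have [e|/gen_at0->] := pselect (dg x = f n); last by rewrite mulr0.
by rewrite (gen_atE s (introT eqP e)); exact: (kp2_ps KP (exist _ (x, n) _)).
Qed.
Lemma lift_sp x n : S x n * P (sc x) = S x n.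
Proof.
have [e|/gen_at0->] := pselect (dg x = f n); last by rewrite mul0r.
by rewrite (gen_atE s (introT eqP e)); exact: (kp2_sp KP (exist _ (x, n) _)).
Qed.
Lemma lift_pt x n : P (sc x) * T x n = T x n.
Proof.
have [e|/gen_at0->] := pselect (dg x = f n); last by rewrite mulr0.
by rewrite (gen_atE t (introT eqP e)); exact: (kp2_pt KP (exist _ (x, n) _)).
Qed.
Lemma lift_tp x n : T x n * P (rg x) = T x n.
Proof.
have [e|/gen_at0->] := pselect (dg x = f n); last by rewrite mul0r.
by rewrite (gen_atE t (introT eqP e)); exact: (kp2_tp KP (exist _ (x, n) _)).
Qed.

Lemma lift_ts x y n : dg x = f n -> dg y = f n ->
  T x n * S y n = if x == y then P (sc x) else 0.
Proof.
move=> dx dy; rewrite (gen_atE t (introT eqP dx)) (gen_atE s (introT eqP dy)).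
rewrite (kp3 KP)// -[_ == _]val_eqE /=.
by rewrite xpair_eqE eqxx andbT.
Qed.

Lemma lift_s_idp v : S (idp v) 0 = P v.
Proof. by rewrite -(kp_s_idp KP) [RHS]gen_at_val. Qed.
Lemma lift_t_idp v : T (idp v) 0 = P v.
Proof. by rewrite -(kp_t_idp KP) [RHS]gen_at_val. Qed.

Lemma lift_ss0 x y m n : sc x <> rg y -> S x m * S y n = 0.
Proof.
move=> xy; rewrite -(lift_sp x) -(lift_ps y) -mulrA (mulrA (p _)) (kp1 KP).
by case: eqP => // _; rewrite mul0r mulr0.
Qed.
Lemma lift_tt0 x y m n : sc x <> rg y -> T y n * T x m = 0.
Proof.
move=> xy; rewrite -(lift_tp y) -(lift_pt x) -mulrA (mulrA (p _)) (kp1 KP).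
by case: eqP => [e|]; [case: xy | rewrite mul0r mulr0].
Qed.

Lemma one_level n : 1 = \sum_(x <- level G (f n)) S x n * T x n.
Proof.
rewrite -p1 (vsum_level rfp fv KP n).
transitivity (\sum_(z <- level PB n) S (val z).1 n * T (val z).1 n).
  rewrite big_seq [RHS]big_seq; apply: eq_bigr => z; rewrite mem_level// => /eqP.
  by move=> dz; rewrite [s z]gen_at_val [t z]gen_at_val [(val z).2]dz.
rewrite -(big_map (fun z : kpath PB => (val z).1) xpredT (fun x => S x n * T x n)).
apply: perm_big; apply: uniq_perm; last first.
- move=> x; rewrite mem_level//; apply/mapP/eqP => [[z]|e].
    rewrite mem_level// => /eqP dz ->; rewrite -dz; apply/eqP.
    exact: (valP z).
  by exists (exist _ (x, n) (introT eqP e)); rewrite // mem_level.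
- exact: level_uniq.
- rewrite map_inj_in_uniq ?level_uniq// => z z'.
  rewrite !mem_level// => /eqP dz /eqP dz' e; apply: val_inj.
  rewrite [LHS]surjective_pairing [RHS]surjective_pairing e.
  by rewrite [(val z).2]dz [(val z').2]dz'.
Qed.

(** When [f m = f m'], multiplication by this element turns degree [m'] into
    degree [m] ([degshift_s0]). The units [U_h] are the pairs of positive and
    negative parts; admitting all pairs makes products easy to compute. *)
Definition degshift m m' : A := \sum_(x <- level G (f m)) S x m * T x m'.

Lemma degshift_id m : degshift m m = 1. Proof. by rewrite [RHS](one_level m). Qed.

Lemma degshift_s0 m m' x : f m = f m' -> dg x = f m -> degshift m m' * S x m' = S x m.
Proof.
move=> mm' dx; rewrite /degshift big_distrl /= big_seq.
transitivity (\sum_(y <- level G (f m) | y == x) S x m).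
  rewrite [RHS]big_mkcond [RHS]big_seq; apply: eq_bigr => y.
  rewrite mem_level// => /eqP dy; rewrite -mulrA lift_ts -?mm'//.
  by case: eqP => [->|]; rewrite ?lift_sp// mulr0.
by rewrite big_pred1_uniq ?level_uniq// mem_level// dx.
Qed.

Lemma t_degshift0 m m' x : f m = f m' -> dg x = f m -> T x m * degshift m m' = T x m'.
Proof.
move=> mm' dx; rewrite /degshift big_distrr /= big_seq.
transitivity (\sum_(y <- level G (f m) | y == x) T x m').
  rewrite [RHS]big_mkcond [RHS]big_seq; apply: eq_bigr => y.
  rewrite mem_level// => /eqP dy; rewrite mulrA lift_ts// eq_sym.
  by case: eqP => [->|]; rewrite ?lift_pt// mul0r.
by rewrite big_pred1_uniq ?level_uniq// mem_level// dx.
Qed.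

Lemma degshift_s m m' n x : f m = f m' -> dg x = f (m + n) ->
  degshift m m' * S x (m' + n) = S x (m + n).
Proof.
move=> mm'; rewrite raddfD => /factorP.
move: (pre _ _) (suf _ _) => y z [ab <- da db].
rewrite -!lift_sM -?mm'// mulrA degshift_s0//.
Qed.

Lemma t_degshift m m' n x : f m = f m' -> dg x = f (m + n) ->
  T x (m + n) * degshift m m' = T x (m' + n).
Proof.
move=> mm'; rewrite raddfD => /factorP.
move: (pre _ _) (suf _ _) => y z [ab <- da db].
rewrite -!lift_tM -?mm'// -mulrA t_degshift0//.
Qed.

(** Prolong [x] by all paths [y] of degree [m']. On both sides this gives the
    sum of [s_(x y, n + m) t_(y, m')], since the unit only changes the degree of
    a path that is long enough. *)
Lemma degshift_comm_s m m' x n : f m = f m' -> degshift m m' * S x n = S x n * degshift m m'.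
Proof.
move=> mm'; have [dx|/gen_at0->] := pselect (dg x = f n); last by rewrite mulr0 mul0r.
rewrite -[in LHS](mulr1 (S x n)) (one_level m') !big_distrr /=.
rewrite -mm' big_seq [RHS]big_seq; apply: eq_bigr => y.
rewrite mem_level// => /eqP dy; rewrite !mulrA.
have [xy|xy] := pselect (sc x = rg y); last first.
  by rewrite -[degshift m m' * _ * _]mulrA !lift_ss0// mulr0.
rewrite -[degshift m m' * _ * _]mulrA !lift_sM -?mm'//.
by rewrite [n + m']addrC degshift_s ?[m + n]addrC// dg_cmp// dx dy raddfD.
Qed.

Lemma degshift_comm_t m m' x n : f m = f m' -> degshift m m' * T x n = T x n * degshift m m'.
Proof.
move=> mm'; have [dx|/gen_at0->] := pselect (dg x = f n); last by rewrite mulr0 mul0r.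
rewrite -[in RHS](mul1r (T x n)) (one_level m) !big_distrl /=.
rewrite big_seq [RHS]big_seq; apply: eq_bigr => y.
rewrite mem_level// => /eqP dy; rewrite -!mulrA; congr (_ * _).
have [xy|xy] := pselect (sc x = rg y); last first.
  by rewrite mulrA !lift_tt0// mul0r.
rewrite mulrA !lift_tM -?mm'//.
by rewrite [n + m]addrC t_degshift ?[m' + n]addrC// dg_cmp// dx dy raddfD addrC.
Qed.

Lemma degshift_trans m m' m'' : f m = f m' -> degshift m m' * degshift m' m'' = degshift m m''.
Proof.
move=> mm'; rewrite /degshift -mm' big_distrr /= big_seq [RHS]big_seq; apply: eq_bigr => x.
by rewrite mem_level// => /eqP dx; rewrite mulrA degshift_s0.
Qed.

(** Consequently a shift depends on the difference of its degrees only
    ([degshift_eq]). *)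
Lemma degshift_translate m m' n : f m = f m' -> degshift (m + n) (m' + n) = degshift m m'.
Proof.
move=> mm'; have e : f (m + n) = f (m' + n) by rewrite !raddfD /= mm'.
rewrite -[RHS]mulr1 (one_level (m' + n)) -e big_distrr /= [LHS]big_seq.
rewrite [RHS]big_seq; apply: eq_bigr => x; rewrite mem_level// => /eqP dx.
by rewrite mulrA degshift_s.
Qed.

Lemma degshift_add m m' n n' : f m = f m' -> f n = f n' ->
  degshift m m' * degshift n n' = degshift (m + n) (m' + n').
Proof.
move=> mm' nn'; rewrite -(degshift_translate n mm') -(degshift_translate m' nn').
rewrite ![_ + m']addrC degshift_trans//.
by rewrite !raddfD /= mm'.
Qed.

Lemma degshift_eq m m' n n' : f m = f m' -> f n = f n' -> m + n' = n + m' ->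
  degshift m m' = degshift n n'.
Proof.
move=> mm' nn' e; rewrite -(degshift_translate n' mm') -(degshift_translate m' nn') e.
by rewrite [m' + _]addrC.
Qed.

Lemma Uelt_degshift h : f (posp h) = f (negp h) -> Uelt s t h = degshift (posp h) (negp h).
Proof. by move=> _; rewrite /Uelt level_sum. Qed.

Lemma degshift_central m m' (spanA : forall a, combo (fun xy => s xy.1 * t xy.2) a) a :
  f m = f m' -> degshift m m' * a = a * degshift m m'.
Proof.
move=> mm'; have [L ->] := spanA a; rewrite big_distrr big_distrl /=.
apply: eq_bigr => j _.
rewrite mulrA -scal_central -!mulrA; congr (_ * _).
rewrite mulrA [s _]gen_at_val [t _]gen_at_val degshift_comm_s// -mulrA degshift_comm_t//.
Qed.

End PullbackFamily.

(** * Aperiodic paths inside a maximal tail *)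

Lemma infpath_ext l (G : kgraph l) (x x' : infpath G) :
  (forall p, ip_obj x p = ip_obj x' p) ->
  (forall p q (pq : leN p q), ip_mor x pq = ip_mor x' pq) -> x = x'.
Proof.
case: x x' => o m a b c d e [o' m' a' b' c' d' e'] /= /funext oo mm.
have {}mm : m = m'.
  by apply: functional_extensionality_dep => p;
     apply: functional_extensionality_dep => q;
     apply: functional_extensionality_dep => pq.
move: a b c d e a' b' c' d' e'; rewrite oo mm => *.
by congr InfPath; exact: Prop_irrelevance.
Qed.

Section TailPaths.
Variables (l : nat) (G : kgraph l).
Implicit Types (m n : NN l).

Lemma leN0n n : leN 0 n. Proof. by apply/forallP => i; rewrite ffunE. Qed.
Lemma leN_addr m n : leN m (m + n).
Proof. by apply/forallP => i; rewrite !ffunE leq_addr. Qed.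
Lemma leNn n : leN n n. Proof. by apply/forallP => i. Qed.

Variable T : maxtail G.

Lemma tail_compl_hereditary : hereditary (~` mt_set T).
Proof. by move=> v w vT vw wT; apply: vT; exact: mt1 wT vw. Qed.

Lemma tail_compl_saturated : saturated (~` mt_set T).
Proof.
move=> v [n [_ sub]] Tv; have [x [ox Tx]] := mt2 n Tv.
by apply: (sub (sc x)) => //; exists x.
Qed.

Lemma tail_compl_proper : ~` mt_set T <> setT.
Proof.
by have [v Tv] := mt_nonempty T; move=> /seteqP[_ /(_ v)]; apply.
Qed.

Section FromInfpath.
Variable x : infpath (kminus tail_compl_hereditary).

Let seg m n (mn : leN m n) : kpath G := val (ip_mor x mn).

Lemma seg_dg m n (mn : leN m n) : dg (seg mn) = [ffun i => (n i - m i)%N].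
Proof. exact: (ip_dg x mn). Qed.

Lemma seg_rg m n (mn : leN m n) : rg (seg mn) = val (ip_obj x m).
Proof. exact: (congr1 val (ip_rg x mn)). Qed.
Lemma seg_sc m n (mn : leN m n) : sc (seg mn) = val (ip_obj x n).
Proof. exact: (congr1 val (ip_sc x mn)). Qed.

Lemma seg_cmp m n q (mn : leN m n) (nq : leN n q) (mq : leN m q) :
  cmp (seg mn) (seg nq) = seg mq.
Proof.
rewrite [RHS](congr1 val (ip_cmp x mn nq mq)); symmetry.
exact: (minus_cmpE (etrans (ip_sc x mn) (esym (ip_rg x nq)))).
Qed.

Lemma obj_tail m : mt_set T (val (ip_obj x m)).
Proof. by have /negP := valP (ip_obj x m); rewrite inE => /contrapT. Qed.

Lemma init_dg n : dg (seg (leN0n n)) = n.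
Proof. by rewrite seg_dg; apply/ffunP => i; rewrite !ffunE subn0. Qed.
Lemma init_T n : mt_set T (sc (seg (leN0n n))).
Proof. by rewrite seg_sc; exact: obj_tail. Qed.
Lemma init_split m n : seg (leN0n (m + n)) = cmp (seg (leN0n m)) (seg (leN_addr m n)).
Proof. by rewrite (seg_cmp _ _ (leN0n (m + n))). Qed.
Lemma init_pre m n : pre m (seg (leN0n (m + n))) = seg (leN0n m).
Proof.
by rewrite init_split -{1}(init_dg m) pre_cmp// seg_sc seg_rg.
Qed.
Lemma init_suf m n : suf m (seg (leN0n (m + n))) = seg (leN_addr m n).
Proof.
by rewrite init_split -{1}(init_dg m) suf_cmp// seg_sc seg_rg.
Qed.

Definition init_bpath : bpath (mt_set T) := BPath init_dg init_T init_pre.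

(** Equality of the two shifts says that the segments from [m] and from [n]
    agree; unique factorisation gives the later segments. *)
Lemma shift_init_eq m n : bshift m init_bpath = bshift n init_bpath ->
  pathshift m x = pathshift n x.
Proof.
move=> e.
have seg0 j : seg (leN_addr m j) = seg (leN_addr n j).
  by rewrite -!init_suf; exact: (congr1 (fun y : bpath _ => y j) e).
have segE p q (pq : leN p q) (pqm : leN (p + m) (q + m)) (pqn : leN (p + n) (q + n)) :
    seg pqm = seg pqn.
  have seg1 j (mj : leN m (j + m)) (nj : leN n (j + n)) : seg mj = seg nj.
    move: mj nj; rewrite [j + m]addrC [j + n]addrC => mj nj.
    by rewrite (Prop_irrelevance mj (leN_addr m j)) (Prop_irrelevance nj (leN_addr n j)).
  have le1 (i j : NN l) : leN i (j + i) by rewrite addrC; exact: leN_addr.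
  have := seg1 q (le1 m q) (le1 n q).
  rewrite -(seg_cmp (le1 m p) pqm) -(seg_cmp (le1 n p) pqn).
  case/factor_uniq => //; rewrite ?seg_sc ?seg_rg//.
  by rewrite (seg1 p _ (le1 n p)).
have morE p q pq : ip_mor (pathshift m x) (p := p) (q := q) pq =
    ip_mor (pathshift n x) pq.
  by apply: val_inj; exact: segE.
apply: infpath_ext => // p.
have := morE p p (leNn p).
by move=> /(congr1 (@rg _ _)); rewrite !ip_rg.
Qed.

End FromInfpath.

Lemma aperiodic_bpath : strongly_aperiodic G -> forall v, mt_set T v ->
  exists y : bpath (mt_set T), brg y = v /\
    forall m n, m <> n -> bshift m y <> bshift n y.
Proof.
move=> /(_ _ tail_compl_hereditary tail_compl_saturated tail_compl_proper) ap v Tv.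
have vL : v \notin ~` mt_set T by apply/negP; rewrite inE; apply.
have [x [xv xap]] := ap (exist _ v vL).
exists (init_bpath x); split; last by move=> m n mn /shift_init_eq; exact: xap.
by rewrite /brg /= (seg_rg x (leN0n 0)) xv.
Qed.

(** Each of the finitely many pairs of shifts differs at a finite stage, so a
    long enough initial segment of one aperiodic infinite path separates all of
    them. *)
Lemma aperiodic_segment : strongly_aperiodic G -> forall v (D : seq (NN l * NN l)),
  mt_set T v -> (forall d, d \in D -> d.1 <> d.2) ->
  exists al : kpath G, [/\ rg al = v, mt_set T (sc al) &
   forall d, d \in D -> exists b c c' ,
    [/\ dg al = d.1 + b + c, dg al = d.2 + b + c' &
      pre b (suf d.1 al) <> pre b (suf d.2 al)] ].
Proof.
move=> sa v D Tv Dne; have [y [<- yap]] := aperiodic_bpath sa Tv.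
have [N HN] : exists N : NN l, forall d, d \in D -> exists b c c',
    [/\ N = d.1 + b + c, N = d.2 + b + c' & suf d.1 (y (d.1 + b)) <> suf d.2 (y (d.2 + b))].
  elim: D Dne => [|[m n] D IH] Dne; first by exists 0.
  have [|N HN] := IH; first by move=> d dD; apply: Dne; rewrite inE dD orbT.
  have mn : m <> n by apply: (Dne (m, n)); rewrite inE eqxx.
  have [b hb] : exists b, suf m (y (m + b)) <> suf n (y (n + b)).
    apply: contrapT => nb; apply: (yap m n mn); apply: bpath_ext => b /=.
    by apply: contrapT => e; apply: nb; exists b.
  (* both m + b and n + b are below the new bound *)
  exists (N + (m + n + b)) => d; rewrite inE => /predU1P[->|/HN].
    exists b, (N + n), (N + m); split=> //=.
      by rewrite (addrAC m n b) addrCA.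
    by rewrite (addrC m n) (addrAC n m b) addrCA.
  move=> [b' [c [c' [e e' ne]]]]; exists b', (c + (m + n + b)), (c' + (m + n + b)).
  by split=> //; rewrite [RHS]addrA -?e -?e'.
exists (y N); split; [exact: bp_rg|exact: bp_T|].
move=> d /HN[b [c [c' [e e' ne]]]]; exists b, c, c'; rewrite bp_dg; split=> //.
by rewrite (@pre_suf _ _ _ _ c) ?bp_dg// (@pre_suf _ _ _ _ c') ?bp_dg// {1}e {1}e' !bp_pre.
Qed.

End TailPaths.

(** * Characters of the kernel and a section of the degree map *)

Section Characters.
Variables (K : fieldType) (r : nat).
Implicit Types (a : torus K r) (c d : ZZ r).

Definition ev a c : K := \prod_i a i ^ c i.
Definition unitZ (i : 'I_r) : ZZ r := [ffun j => Posz (i == j)].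

Lemma ev0 a : ev a 0 = 1.
Proof. by apply: big1 => i _; rewrite ffunE expr0z. Qed.

Lemma evD a c d : ev a (c + d) = ev a c * ev a d.
Proof.
rewrite -big_split; apply: eq_bigr => i _ /=.
by rewrite ffunE expfzDr// tvalP.
Qed.

Lemma ev_neq0 a c : ev a c != 0.
Proof. by apply/prodf_neq0 => i _; apply: expfz_neq0; exact: tvalP. Qed.

Lemma ev_unit a i : ev a (unitZ i) = a i.
Proof.
rewrite /ev (bigD1 i)//= big1 ?mulr1 ?ffunE ?eqxx ?expr1z// => j ji.
by rewrite ffunE eq_sym (negbTE ji) expr0z.
Qed.
End Characters.

Section Fbar.
Variables (k l : nat) (f : {additive NN k -> NN l}).

Lemma fbar_additive : zmod_morphism (fbar f).
Proof.
move=> x y; set m := posp x + negp y; set n := negp x + posp y.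
have -> : x - y = toZZ m - toZZ n.
  by rewrite /m /n !toZZD -{1}(pospB x) -{1}(pospB y) !opprD opprK
             [- toZZ (posp y) + _]addrC addrACA.
rewrite fbar_toZZB /m /n !(raddfD f) !toZZD /fbar !opprD opprK.
by rewrite [- toZZ (f (posp y)) + _]addrC [RHS]addrACA.
Qed.
HB.instance Definition _ := GRing.isZmodMorphism.Build _ _ (fbar f) fbar_additive.

Lemma fbar_eq0 m n : (fbar f (toZZ m - toZZ n) = 0) <-> (f m = f n).
Proof.
rewrite fbar_toZZB; split=> [/eqP|->]; last by rewrite subrr.
by rewrite subr_eq0 => /eqP/toZZ_inj.
Qed.

Hypothesis f_surj : forall m : NN l, exists n : NN k, f n = m.

Definition unitN (i : 'I_l) : NN l := [ffun j => (i == j) : nat].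

Definition lift_unit (i : 'I_l) : NN k := sval (cid (f_surj (unitN i))).
(** [N^l] is free on its generators, so any preimages of these extend to a
    monoid section of [f]. *)
Definition msection (m : NN l) : NN k := \sum_i lift_unit i *+ m i.

Lemma msectionD m n : msection (m + n) = msection m + msection n.
Proof.
rewrite /msection -big_split; apply: eq_bigr => i _.
by rewrite ffunE mulrnDr.
Qed.

Lemma msection0 : msection 0 = 0.
Proof. by apply: big1 => i _; rewrite ffunE mulr0n. Qed.

Lemma msectionK m : f (msection m) = m.
Proof.
rewrite /msection raddf_sum; apply/ffunP => j; rewrite sum_ffunE.
rewrite (bigD1 j)//= big1 ?addr0 => [|i ij].
  rewrite raddfMn /lift_unit; case: cid => /= x ->.
  rewrite ffunMnE ffunE eqxx.
  by elim: (m j) => // n IH; rewrite mulrS IH.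
rewrite raddfMn /lift_unit; case: cid => /= x ->.
by rewrite ffunMnE ffunE (negbTE ij) mul0rn.
Qed.

End Fbar.

(** * Simple modules from maximal left ideals *)

Section LeftIdeals.
Variable A : pzRingType.

Lemma annihilator_ideal (N : lmodType A) : ideal2 (annihilator N).
Proof.
split=> /=.
- by move=> m; rewrite scale0r.
- by move=> x y x0 y0 m; rewrite scalerDl x0 y0 addr0.
- by move=> a x x0 m; rewrite -scalerA x0 scaler0.
- by move=> a x x0 m; rewrite -scalerA x0.
Qed.

Record left_ideal := LeftIdeal {
  lideal :> A -> Prop;
  lideal0 : lideal 0;
  lidealB : forall x y, lideal x -> lideal y -> lideal (x - y);
  lidealM : forall a x, lideal x -> lideal (a * x)
}.

Section Quotient.
Variable N : left_ideal.

Definition lideal_pred : {pred A} := fun x => `[< N x >].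

Lemma lideal_predP x : reflect (N x) (x \in lideal_pred).
Proof. exact: asboolP. Qed.

Lemma lideal_pred_closed : zmod_closed lideal_pred.
Proof.
split; first by apply/lideal_predP; exact: lideal0.
by move=> x y /lideal_predP Nx /lideal_predP Ny; apply/lideal_predP; exact: lidealB.
Qed.
HB.instance Definition _ := GRing.isZmodClosed.Build A lideal_pred lideal_pred_closed.

Definition quotient_module := Quotient.quot (lideal_pred : zmodClosed A).
HB.instance Definition _ := GRing.Zmodule.on quotient_module.
HB.instance Definition _ := EqQuotient.on quotient_module.

Definition mclass (x : A) : quotient_module := (\pi_quotient_module x)%qT.

Lemma mclassE x y : mclass x = mclass y <-> N (x - y).
Proof.
split=> [e|/lideal_predP].
  by apply/lideal_predP; rewrite Quotient.idealrBE; apply/eqP; exact: e.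
by rewrite Quotient.idealrBE => /eqP.
Qed.

Lemma mclassD x y : mclass x + mclass y = mclass (x + y).
Proof. by rewrite /mclass !piE. Qed.

Definition mscale (a : A) (m : quotient_module) : quotient_module :=
  mclass (a * repr m).

Lemma mclass_repr m : mclass (repr m) = m. Proof. exact: reprK. Qed.

Lemma mscale_class a x : mscale a (mclass x) = mclass (a * x).
Proof.
apply/mclassE; rewrite -mulrBr; apply: lidealM; apply/mclassE.
exact: mclass_repr.
Qed.

Lemma mscaleA a b m : mscale a (mscale b m) = mscale (a * b) m.
Proof. by rewrite -(mclass_repr m) !mscale_class mulrA. Qed.
Lemma mscale1 : left_id 1 mscale.
Proof. by move=> m; rewrite -(mclass_repr m) mscale_class mul1r. Qed.
Lemma mscaleDr : right_distributive mscale +%R.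
Proof.
move=> a m m'; rewrite -(mclass_repr m) -(mclass_repr m').
by rewrite mclassD !mscale_class mclassD mulrDr.
Qed.
Lemma mscaleDl m : {morph mscale^~ m : a b / a + b}.
Proof.
by move=> a b; rewrite -(mclass_repr m) !mscale_class mclassD mulrDl.
Qed.
HB.instance Definition _ := GRing.Zmodule_isLmodule.Build A quotient_module
  mscaleA mscale1 mscaleDr mscaleDl.

Lemma scale_mclass a x : a *: mclass x = mclass (a * x).
Proof. exact: mscale_class. Qed.

End Quotient.

Definition maximal_left (N : left_ideal) := ~ N 1 /\
  forall N' : left_ideal, (forall x, N x -> N' x) -> ~ N' 1 -> forall x, N' x -> N x.

(** Zorn's lemma for proper left ideals above [N0]. *)
Lemma exists_maximal_left (N0 : left_ideal) : ~ N0 1 ->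
  exists N : left_ideal, (forall x, N0 x -> N x) /\ maximal_left N.
Proof.
move=> N01.
(* chains may be empty, hence the empty set is admitted as well *)
pose good (X : set A) := exists N : left_ideal, [/\ X = N :> set A, forall x, N0 x -> N x & ~ N 1].
pose Q (X : set A) := X = set0 \/ good X.
have [|X [QX Xmax]] := @Zorn_bigcup A Q.
  move=> F FQ Ftot.
  have [[X [FX X0]]|none] := pselect (exists X, F X /\ X !=set0); last first.
    left; apply/seteqP; split=> // x [X FX Xx]; case: none.
    by exists X; split=> //; exists x.
  have gX Y y : F Y -> Y y -> good Y.
    by move=> FY Yy; case: (FQ Y FY) => // Y0; rewrite Y0 in Yy.
  have [x0 Xx0] := X0; have [N [XN N0N N1]] := gX X x0 FX Xx0.
  have B0 : (\bigcup_(Y in F) Y) 0 by exists X => //; rewrite XN; exact: lideal0.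
  have BB x y : (\bigcup_(Y in F) Y) x -> (\bigcup_(Y in F) Y) y -> (\bigcup_(Y in F) Y) (x - y).
    move=> [Y FY Yx] [Y' FY' Yy].
    have [YY|YY] := Ftot Y Y' FY FY'.
      have [N' [E _ _]] := gX _ _ FY' Yy; exists Y' => //.
      by have := YY _ Yx; move: Yy; rewrite E => *; exact: lidealB.
    have [N' [E _ _]] := gX _ _ FY Yx; exists Y => //.
    by have := YY _ Yy; move: Yx; rewrite E => *; exact: lidealB.
  have BM a x : (\bigcup_(Y in F) Y) x -> (\bigcup_(Y in F) Y) (a * x).
    move=> [Y FY Yx]; have [N' [E _ _]] := gX _ _ FY Yx; exists Y => //.
    by move: Yx; rewrite E; exact: lidealM.
  right; exists (LeftIdeal B0 BB BM); split=> //=.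
    by move=> x /N0N Nx; exists X => //; rewrite XN.
  move=> [Y FY Y1]; have [N' [E _ N'1]] := gX _ _ FY Y1.
  by apply: N'1; rewrite E in Y1.
have g0 : good N0 by exists N0.
have [N [XN N0N N1]] : good X.
  case: QX => // X0; case: (Xmax (N0 : set A)); last by right.
  by rewrite X0; split=> [? []|/(_ 0 (lideal0 N0))].
exists N; split=> //; split=> // N' NN' N'1 x N'x; apply: contrapT => Nx.
case: (Xmax (N' : set A)); last by right; exists N'; split=> // y /N0N/NN'.
by rewrite XN; split=> // /(_ x N'x).
Qed.

Lemma mclass0 (N : left_ideal) : mclass N 0 = 0.
Proof. by rewrite -(mul0r 0) -scale_mclass scale0r. Qed.

Lemma mclass_eq0 (N : left_ideal) x : mclass N x = 0 <-> N x.
Proof. by rewrite -mclass0 mclassE subr0. Qed.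

Lemma maximal_left_simple (N : left_ideal) : maximal_left N ->
  simple_module (quotient_module N).
Proof.
move=> [N1 Nmax]; split; first by exists (mclass N 1) => /mclass_eq0.
move=> M [M0 Mlin].
have MB m m' : m \in M -> m' \in M -> m - m' \in M.
  by move=> Mm Mm'; rewrite addrC -scaleN1r; exact: Mlin.
have P0 : mclass N 0 \in M by rewrite mclass0.
have PB x y : mclass N x \in M -> mclass N y \in M -> mclass N (x - y) \in M.
  by move=> Mx My; rewrite -mclassD -mulN1r -scale_mclass scaleN1r; exact: MB.
have PM a x : mclass N x \in M -> mclass N (a * x) \in M.
  by move=> Mx; rewrite -scale_mclass -[_ *: _]addr0; exact: Mlin.
pose N' := LeftIdeal P0 PB PM.
have NN' x : N x -> N' x by move=> /mclass_eq0 e; rewrite /N' /= e.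
have [N'1|/(Nmax N' NN') sub] := pselect (N' 1).
  right=> m; rewrite -(mclass_repr m) -[repr m]mulr1; exact (PM _ _ N'1).
by left=> m Mm; rewrite -(mclass_repr m); apply/mclass_eq0/sub; rewrite /N' /= mclass_repr.
Qed.

End LeftIdeals.

(** * Central elements act by scalars *)

Section Schur.
Variables (A : pzRingType) (M : lmodType A).
Hypothesis sM : simple_module M.

Lemma simple_generated (m0 : M) : m0 <> 0 -> forall m, exists a, a *: m0 = m.
Proof.
move=> m00; pose N : {pred M} := fun m => `[< exists a, a *: m0 = m >].
have [_ /(_ N)] := sM; case.
- split; first by apply/asboolP; exists 0; rewrite scale0r.
  move=> b u v /asboolP[c <-] /asboolP[d <-]; apply/asboolP; exists (b * c + d).
  by rewrite scalerDl scalerA.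
- move=> N0; case: m00; apply: N0; apply/asboolP; exists 1.
  by rewrite scale1r.
- by move=> NT m; have /asboolP := NT m.
Qed.

Lemma schur (w : A) : (forall a, w * a = a * w) -> ~ (forall m : M, w *: m = 0) ->
  (forall m : M, w *: m = 0 -> m = 0) /\ (forall m : M, exists m', w *: m' = m).
Proof.
move=> cw nw; split.
  pose N : {pred M} := fun m => `[< w *: m = 0 >].
  have [_ /(_ N)] := sM; case.
  - split; first by apply/asboolP; rewrite scaler0.
    move=> b u v /asboolP u0 /asboolP v0; apply/asboolP.
    by rewrite scalerDr scalerA cw -scalerA u0 v0 scaler0 addr0.
  - by move=> N0 m m0; apply: N0; apply/asboolP.
  - by move=> NT; case: nw => m; have /asboolP := NT m.
pose N : {pred M} := fun m => `[< exists m', w *: m' = m >].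
have [_ /(_ N)] := sM; case.
- split; first by apply/asboolP; exists 0; rewrite scaler0.
  move=> b u v /asboolP[u' <-] /asboolP[v' <-]; apply/asboolP; exists (b *: u' + v').
  by rewrite scalerDr !scalerA cw.
- by move=> N0; case: nw => m; apply: N0; apply/asboolP; exists m.
- by move=> NT m; have /asboolP := NT m.
Qed.

End Schur.

Section PolynomialAction.
Variables (K : fieldType) (A : ualg K) (M : lmodType A) (z : A).
Hypothesis cz : forall a, z * a = a * z.
Implicit Types (q : {poly K}) (m : M).

(** The action of [q(z)], written as an explicit sum because [A] may be the zero
    ring. *)
Definition pact q m : M := \sum_(i < size q) (scal A q`_i * z ^+ i) *: m.

Lemma pact_wide n q m : (size q <= n)%N ->
  pact q m = \sum_(i < n) (scal A q`_i * z ^+ i) *: m.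
Proof.
move=> qn; rewrite /pact (big_ord_widen n (fun i => (scal A q`_i * z ^+ i) *: m))//.
rewrite big_mkcond; apply: eq_bigr => i _; case: ltnP => // /(nth_default 0) ->.
by rewrite rmorph0 mul0r scale0r.
Qed.

Lemma pactD q q' m : pact (q + q') m = pact q m + pact q' m.
Proof.
set n := maxn (size q) (size q').
rewrite (@pact_wide n (q + q')); last exact: size_polyD.
rewrite (@pact_wide n q) ?leq_maxl// (@pact_wide n q') ?leq_maxr//.
rewrite -big_split; apply: eq_bigr => i _.
by rewrite coefD rmorphD mulrDl scalerDl.
Qed.

Lemma pactZ c q m : pact (c *: q) m = scal A c *: pact q m.
Proof.
rewrite (@pact_wide (size q) (c *: q)) ?size_scale_leq// /pact scaler_sumr.
by apply: eq_bigr => i _; rewrite coefZ rmorphM scalerA mulrA.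
Qed.

Lemma pact0 m : pact 0 m = 0.
Proof. by rewrite /pact size_poly0 big_ord0. Qed.

Lemma pact1 m : pact 1 m = m.
Proof. by rewrite /pact size_poly1 big_ord1 coef1 rmorph1 mul1r expr0 scale1r. Qed.

Lemma pact_sum (I : Type) (L : seq I) (Q : I -> {poly K}) m :
  pact (\sum_(i <- L) Q i) m = \sum_(i <- L) pact (Q i) m.
Proof. by apply: (big_morph (pact^~ m)) => [? ?|]; [exact: pactD|exact: pact0]. Qed.

Lemma pact_central q (a : A) m : (forall b, a * b = b * a) ->
  pact q (a *: m) = a *: pact q m.
Proof.
move=> ca; rewrite /pact scaler_sumr; apply: eq_bigr => i _.
by rewrite !scalerA ca.
Qed.

Lemma pact_scal q c m : pact q (scal A c *: m) = scal A c *: pact q m.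
Proof. by apply: pact_central => b; exact: scal_central. Qed.

Lemma pact_vecsum (I : Type) (L : seq I) q (x : I -> M) :
  pact q (\sum_(i <- L) x i) = \sum_(i <- L) pact q (x i).
Proof.
rewrite /pact exchange_big; apply: eq_bigr => i _ /=.
by rewrite scaler_sumr.
Qed.

Lemma pactMX q m : pact (q * 'X) m = z *: pact q m.
Proof.
rewrite (@pact_wide (size q).+1); last first.
  have [->|q0] := eqVneq q 0; first by rewrite mul0r size_poly0.
  by rewrite size_mulX.
rewrite big_ord_recl coefMX /= rmorph0 mul0r scale0r add0r /pact scaler_sumr.
apply: eq_bigr => i _; rewrite coefMX /= /bump /= add1n /= exprS.
by rewrite scalerA; congr (_ *: _); rewrite !mulrA (cz (scal A _)).
Qed.

Lemma pact_linear_factor q c m : pact (q * ('X - c%:P)) m = (z - scal A c) *: pact q m.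
Proof.
rewrite mulrBr pactD -scaleN1r pactZ pactMX mulrC mul_polyC pactZ scalerBl.
by rewrite rmorphN1 scaleN1r.
Qed.

End PolynomialAction.

Section Dixmier.
Variables (K : closedFieldType) (A : ualg K) (M : lmodType A).
Variables (J : countType) (E : J -> A).
Hypothesis uK : ~ countable [set: K].
Hypothesis span : forall a, combo E a.
Hypothesis sM : simple_module M.
Variable z : A.
Hypothesis cz : forall a, z * a = a * z.

Lemma shifted_central c a : (z - scal A c) * a = a * (z - scal A c).
Proof. by rewrite mulrBl mulrBr cz scal_central. Qed.

(** Over an algebraically closed field [q(z)] is a nonzero scalar times a product
    of elements [z - c]. *)
Lemma pact_inj (q : {poly K}) (m : M) : q != 0 ->
  (forall c (m : M), (z - scal A c) *: m = 0 -> m = 0) -> pact z q m = 0 -> m = 0.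
Proof.
move=> q0 inj; have [s ->] := closed_field_poly_normal q.
rewrite pactZ => /(congr1 (fun x => scal A (lead_coef q)^-1 *: x)).
rewrite scaler0 scalerA -rmorphM mulVf ?lead_coef_eq0// rmorph1 scale1r.
elim: s => [|c s IH]; first by rewrite big_nil pact1.
by rewrite big_cons mulrC pact_linear_factor// => /inj.
Qed.

(** A countable spanning family of the module generated by [m0], padded by zero
    at the numbers that encode no index. *)
Definition basis_vec (m0 : M) (n : nat) : M :=
  if choice.unpickle n is Some j then E j *: m0 else 0.

Lemma finite_combination (m0 : M) a : exists n (c : nat -> K),
  a *: m0 = \sum_(i < n) scal A (c i) *: basis_vec m0 i.
Proof.
have [L ->] := span a; elim: L => [|[c j] L [n [d IH]]].
  by exists 0%N, (fun=> 0); rewrite big_nil scale0r big_ord0.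
pose N := maxn n (choice.pickle j).+1.
exists N, (fun i => (if i == choice.pickle j then c else 0) + if (i < n)%N then d i else 0).
rewrite big_cons scalerDl IH.
under [RHS]eq_bigr do rewrite rmorphD scalerDl; rewrite big_split /=; congr (_ + _).
  have jN : (choice.pickle j < N)%N by rewrite leq_max leqnn orbT.
  rewrite (bigD1 (Ordinal jN))//= eqxx /basis_vec choice.pickleK scalerA big1 ?addr0// => i ij.
  rewrite ifN ?rmorph0 ?scale0r//.
rewrite (big_ord_widen N (fun i => scal A (d i) *: basis_vec m0 i)) ?leq_maxl//.
rewrite big_mkcond; apply: eq_bigr => i _; case: ifP => // _.
by rewrite rmorph0 scale0r.
Qed.

(** Dixmier's argument. If no [z - c] acts by zero, then all act invertibly, by
    Schur's lemma. Choose [m0] nonzero and solve [(z - c) res(c) = m0] for every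
    [c]. The vectors [res c] are uncountably many in a space of countable
    dimension, so some are linearly dependent; clearing denominators gives
    [q(z) m0 = 0] with [q] nonzero, against injectivity. *)
Theorem central_scalar : exists c, forall m : M, (z - scal A c) *: m = 0.
Proof.
apply: contrapT => nc.
have sch c : (forall m : M, (z - scal A c) *: m = 0 -> m = 0) /\
    (forall m : M, exists m', (z - scal A c) *: m' = m).
  apply: schur => //; first exact: shifted_central.
  by move=> c0; apply: nc; exists c.
have inj c (m : M) : (z - scal A c) *: m = 0 -> m = 0 by case: (sch c) => + _; apply.
have [[m0 m00] _] := sM.
have [res resE] := choice (fun c => (sch c).2 m0).
have fc c : exists n (d : nat -> K),
    res c = \sum_(i < n) scal A (d i) *: basis_vec m0 i.
  by have [a <-] := simple_generated sM m00 (res c); exact: finite_combination.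
have [nn /choice[d dE]] := choice fc.
have [n infn] : exists n, infinite_set [set c | nn c = n].
  apply: contrapT => fin; apply: uK.
  have -> : [set: K] = \bigcup_(n in [set: nat]) [set c | nn c = n].
    by apply/seteqP; split=> // c _; exists (nn c).
  apply: bigcup_countable => // n _; apply: finite_set_countable.
  by apply: contrapT => infn; apply: fin; exists n.
have [B Bn sB] := infinite_set_fset n.+1 infn.
pose kap (j : 'I_n.+1) : K := nth 0 (B : seq K) j.
have jB (j : 'I_n.+1) : (j < size (B : seq K))%N by exact: leq_trans sB.
have kapB j : nn (kap j) = n.
  by apply: Bn => /=; apply: mem_nth.
have kapI : injective kap.
  move=> i j /eqP; rewrite nth_uniq ?fset_uniq// => /eqP; exact: val_inj.
pose C : 'M[K]_(n.+1, n) := \matrix_(j, i) d (kap j) i.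
have resC j : res (kap j) = \sum_(i < n) scal A (C j i) *: basis_vec m0 i.
  have := dE (kap j); rewrite kapB => ->; apply: eq_bigr => i _.
  by rewrite mxE.
have : kermx C != 0.
  rewrite kermx_eq0 /row_free; apply/eqP => rk.
  by have := rank_leq_col C; rewrite rk ltnn.
move=> /rowV0Pn[v /sub_kermxP vC v0].
have [j0 vj0] : exists j, v 0 j != 0.
  apply: contrapT => nv; case/negP: v0; apply/eqP/rowP => j; rewrite mxE.
  by apply/eqP; apply: contrapT => /negP vj; apply: nv; exists j.
have dep : \sum_j scal A (v 0 j) *: res (kap j) = 0.
  under eq_bigr do rewrite resC scaler_sumr.
  rewrite exchange_big big1//= => i _.
  transitivity (scal A ((v *m C) 0 i) *: basis_vec m0 i); last first.
    by rewrite vC mxE rmorph0 scale0r.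
  rewrite mxE rmorph_sum scaler_suml; apply: eq_bigr => j _.
  by rewrite scalerA -rmorphM.
pose Pi (D : pred 'I_n.+1) : {poly K} := \prod_(i | D i) ('X - (kap i)%:P).
have PiE j : Pi predT = Pi (predC1 j) * ('X - (kap j)%:P).
  by rewrite /Pi (bigD1 j)//= mulrC.
(* the numerator of the sum of the v_j / (X - kap_j) *)
pose q : {poly K} := \sum_j v 0 j *: Pi (predC1 j).
have q0 : q != 0.
  apply/eqP => /(congr1 (horner^~ (kap j0))); rewrite horner0 /q horner_sum.
  rewrite (bigD1 j0)//= big1 ?addr0 => [|j jj0]; last first.
    rewrite hornerZ /Pi horner_prod (bigD1 j0) ?inE 1?eq_sym//=.
    by rewrite hornerXsubC subrr mul0r mulr0.
  rewrite hornerZ /Pi horner_prod => /eqP; rewrite mulf_eq0 (negbTE vj0)/=.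
  apply/negP; apply/prodf_neq0 => i ij0.
  by rewrite hornerXsubC subr_eq0 eq_sym (inj_eq kapI).
apply: m00; apply: (pact_inj q0 inj).
rewrite /q pact_sum.
transitivity (\sum_j pact z (Pi predT) (scal A (v 0 j) *: res (kap j))).
  apply: eq_bigr => j _; rewrite pactZ pact_scal; congr (_ *: _).
  rewrite (PiE j) pact_linear_factor// -[in LHS](resE (kap j)).
  by apply: pact_central; exact: shifted_central.
by rewrite -pact_vecsum dep /pact big1// => i _; rewrite scaler0.
Qed.

End Dixmier.

(** * The ideals attached to a maximal tail and a point of the torus *)

Section IdealFacts.
Variables (R : comPzRingType) (A : ualg R) (I : set A).
Hypothesis idI : ideal2 I.

Lemma ideal2D x y : I x -> I y -> I (x + y).
Proof. by case: idI => _ + _ _; apply. Qed.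
Lemma ideal2Ml x y : I y -> I (x * y).
Proof. by case: idI => _ _ + _; apply. Qed.
Lemma ideal2Mr x y : I x -> I (x * y).
Proof. by case: idI => _ _ _; apply. Qed.
Lemma ideal2N x : I x -> I (- x).
Proof. by rewrite -mulN1r; exact: ideal2Ml. Qed.
Lemma ideal2B x y : I x -> I y -> I (x - y).
Proof. by move=> Ix Iy; apply: ideal2D => //; exact: ideal2N. Qed.
Lemma ideal2_sum (J : eqType) (L : seq J) (g : J -> A) :
  (forall j, j \in L -> I (g j)) -> I (\sum_(j <- L) g j).
Proof.
move=> gI; rewrite big_seq; elim/big_ind: _ => //; first by case: idI.
exact: ideal2D.
Qed.
Lemma ideal2_congrM x x' y y' : I (x - x') -> I (y - y') -> I (x * y - x' * y').
Proof.
move=> xx yy; have -> : x * y - x' * y' = (x - x') * y + x' * (y - y').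
  by rewrite mulrBl mulrBr addrA subrK.
by apply: ideal2D; [exact: ideal2Mr|exact: ideal2Ml].
Qed.
End IdealFacts.

Section Core.
Variables (K : fieldType) (l : nat) (G : kgraph l) (A : ualg K).
Variables (P : vertex G -> A) (S T : kpath G -> A).
Variables (r : nat) (U : ZZ r -> A).
Hypotheses (rf : row_finite G) (fv : finite_set [set: vertex G]).
Hypothesis F : KP_family P S T.
Hypothesis P1 : vsum P = 1.
Hypothesis U0 : U 0 = 1.
Hypothesis UD : forall c d : ZZ r, U (c + d) = U c * U d.
Hypothesis U_central : forall c a, U c * a = a * U c.
Hypothesis span : forall a, combo (fun j : ZZ r * (kpath G * kpath G) => U j.1 * S j.2.1 * T j.2.2) a.
Hypothesis sa : strongly_aperiodic G.

Definition tail_ideal (M : maxtail G) (a : torus K r) : set A :=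
  smallest (@ideal2 A)
  ([set P v | v in ~` mt_set M] `|` [set U (unitZ i) - scal A (a i) | i in [set: 'I_r]]).

Definition laurent (q : seq (K * ZZ r)) : A := \sum_(j <- q) scal A j.1 * U j.2.
Definition laurent_ev (a : torus K r) (q : seq (K * ZZ r)) : K :=
  \sum_(j <- q) j.1 * ev a j.2.

Lemma evN (a : torus K r) c : ev a (- c) * ev a c = 1.
Proof. by rewrite -evD addNr ev0. Qed.

Lemma UNK c : U (- c) * U c = 1.
Proof. by rewrite -UD addNr U0. Qed.

Lemma cong_U J (a : torus K r) : ideal2 J -> (forall i, J (U (unitZ i) - scal A (a i))) ->
  forall c, J (U c - scal A (ev a c)).
Proof.
move=> idJ Ji; pose Q c := J (U c - scal A (ev a c)).
have Q0 : Q 0 by rewrite /Q U0 ev0 rmorph1 subrr; case: idJ.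
have QD c d : Q c -> Q d -> Q (c + d).
  by move=> Qc Qd; rewrite /Q UD evD rmorphM; exact: ideal2_congrM.
have QN c : Q c -> Q (- c).
  move=> Qc; rewrite /Q; have -> : U (- c) - scal A (ev a (- c)) =
      - (scal A (ev a (- c)) * U (- c)) * (U c - scal A (ev a c)).
    rewrite mulrBr mulNr mulNr opprK -mulrA UNK mulr1.
    by rewrite -mulrA -scal_central mulrA -rmorphM evN rmorph1 mul1r addrC.
  exact: ideal2Ml.
move=> c; have -> : c = \sum_i unitZ i *~ c i.
  apply/ffunP => j; rewrite sum_ffunE (bigD1 j)//= big1 ?addr0.
    by rewrite ffunMzE ffunE eqxx intz.
  by move=> i ij; rewrite ffunMzE ffunE (negbTE ij) mul0rz.
rewrite -/(Q _); elim/big_ind: _ => // i _.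
have Qn n : Q (unitZ i *+ n).
  by elim: n => [|n IH]; rewrite ?mulr0n// mulrS; apply: QD => //; rewrite /Q ev_unit.
by case: (c i) => n; [exact: Qn | apply: QN; exact: Qn].
Qed.

Lemma cong_laurent J (a : torus K r) : ideal2 J -> (forall i, J (U (unitZ i) - scal A (a i))) ->
  forall q, J (laurent q - scal A (laurent_ev a q)).
Proof.
move=> idJ Ji q; rewrite /laurent /laurent_ev rmorph_sum -sumrB.
apply: ideal2_sum => // j _; rewrite rmorphM -mulrBr.
by apply: ideal2Ml => //; exact: cong_U.
Qed.

(** Paths without a common prolongation have orthogonal ranges. *)
Lemma ts_eq0 x y : (forall z z', sc y = rg z -> sc x = rg z' -> cmp y z <> cmp x z') ->
  T x * S y = 0.
Proof.
move=> ne; rewrite (ts_expand rf fv F) big_seq_cond big1// => z.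
rewrite mem_level// => /andP[/eqP dz /eqP yz]; case: eqP => // e.
have /factorP[ab e' da db] : dg (cmp y z) = dg x + dg y by rewrite dg_cmp// dz addrC.
by case: (ne z (suf (dg x) (cmp y z)) yz); rewrite -?[RHS]e' -{1}e.
Qed.

Definition term (j : K * (ZZ r * kpath G)) : A := scal A j.1 * (U j.2.1 * S j.2.2).

(** Multiplying [b] by [S_x] on the right absorbs all the [T] factors of [b]. *)
Definition reducible b x := exists L : seq (K * (ZZ r * kpath G)),
  (forall j, j \in L -> sc j.2.2 = sc x) /\ b * S x = \sum_(j <- L) term j.

(** [T_y S_x] is a path or zero as soon as [d y] is below [d x]. *)
Lemma eventually_reducible b :
  exists N, forall n x, dg x = N + n -> reducible b x.
Proof.
have [L ->] := span b; elim: L => [|[c [d [x y]]] L [N IH]].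
  by exists 0 => n x _; exists [::]; rewrite !big_nil mul0r; split.
(* degrees are added, not maximised: any common upper bound serves *)
exists (dg y + N) => n z dz.
have [L' [scL' e']] := IH (dg y + n) z (ltac: (by rewrite dz addrCA addrA)).
rewrite big_cons /=.
suff [L0 [scL0 e0]] : reducible (scal A c * (U d * S x * T y)) z.
  exists (L0 ++ L'); split.
    by move=> j; rewrite mem_cat => /orP[]; [exact: scL0|exact: scL'].
  by rewrite mulrDl e0 e' big_cat.
have dz' : dg z = dg y + (N + n) by rewrite addrA.
have [ab e da db] := factorP dz'.
have ts := ts_long F dz'.
case: eqP ts => [ey ts|_ ts]; last first.
  by exists [::]; rewrite big_nil -!mulrA ts !mulr0; split.
have [xs|xs] := pselect (sc x = rg (suf (dg y) z)); last first.
  exists [::]; rewrite big_nil -!mulrA ts (ss0 F xs) !mulr0; split=> //.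
exists [:: (c, (d, cmp x (suf (dg y) z)))]; split.
  by move=> j; rewrite inE => /eqP-> /=; rewrite sc_cmp// (sc_suf dz').
by rewrite big_seq1 /term /= -!mulrA ts (kp2_s F).
Qed.

Section Key.
Variables (M : maxtail G) (a : torus K r).
Local Notation I := (tail_ideal M a).

Lemma tail_ideal_ideal : ideal2 I. Proof. exact: ideal2_smallest. Qed.

Lemma tail_ideal_p v : ~ mt_set M v -> I (P v).
Proof. by move=> Mv J [_ sub]; apply: sub; left; exists v. Qed.

Lemma tail_ideal_U i : I (U (unitZ i) - scal A (a i)).
Proof. by move=> J [_ sub]; apply: sub; right; exists i. Qed.

Lemma tail_ideal_laurent q : I (laurent q - scal A (laurent_ev a q)).
Proof. exact: (cong_laurent tail_ideal_ideal tail_ideal_U). Qed.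

(** The Laurent polynomial that multiplies [S_x] when equal paths are collected. *)
Definition coeff (L : seq (K * (ZZ r * kpath G))) (x : kpath G) : seq (K * ZZ r) :=
  [seq (j.1, j.2.1) | j <- L & j.2.2 == x].

Lemma nonzero_coeff (L : seq (K * (ZZ r * kpath G))) :
  ~ I (\sum_(j <- L) term j) -> exists x, laurent_ev a (coeff L x) != 0.
Proof.
move=> nI; apply: contrapT => nx; apply: nI.
have L0 x : laurent_ev a (coeff L x) = 0.
  by apply/eqP; apply: contrapT => /negP ne; apply: nx; exists x.
have -> : \sum_(j <- L) term j =
    \sum_(x <- undup [seq j.2.2 | j <- L]) laurent (coeff L x) * S x.
  rewrite (@sum_by_fibre _ _ _ _ (undup [seq j.2.2 | j <- L]) (fun j => j.2.2)).
  - apply: eq_bigr => x _; rewrite /laurent /coeff big_map big_filter big_distrl.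
    by apply: eq_bigr => j /eqP<-; rewrite /term mulrA.
  - exact: undup_uniq.
  - by move=> j jL; rewrite mem_undup; exact: (map_f (fun j : K * (ZZ r * kpath G) => j.2.2)).
apply: (ideal2_sum tail_ideal_ideal).
move=> x _; apply: (ideal2Mr tail_ideal_ideal).
by have := tail_ideal_laurent (coeff L x); rewrite L0 rmorph0 subr0.
Qed.

(** Why it holds: some [b S_x] is outside the ideal, and it is a sum of terms
    [q_y(U) S_y] over paths with a common source in [M]. One coefficient has
    [q_y(a)] nonzero. For a segment [al] that separates the shifts by [d y] and
    by the degrees of the other paths, [T_(y al) S_(y' al)] vanishes unless
    [y' = y]. *)
Theorem corner_compression b : ~ I b -> exists u w v q,
  [/\ mt_set M v, laurent_ev a q != 0 & u * b * w = laurent q * P v].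
Proof.
move=> nIb; have idI := tail_ideal_ideal; have [N red] := eventually_reducible b.
have [x [dx nIx]] : exists x, dg x = N /\ ~ I (b * S x).
  apply: contrapT => nx; apply: nIb.
  rewrite -[b]mulr1 -P1 (vsum_level rf fv F N) big_distrr /=.
  apply: (ideal2_sum idI) => // x; rewrite mem_level// => /eqP dx.
  rewrite mulrA; apply: (ideal2Mr idI) => //; apply: contrapT => nI.
  by apply: nx; exists x.
have Mx : mt_set M (sc x).
  apply: contrapT => nM; apply: nIx; rewrite -(kp2_sp F) mulrA.
  by apply: (ideal2Ml idI) => //; exact: tail_ideal_p.
have [L [scL e]] := red 0 x (ltac: (by rewrite addr0)).
rewrite e in nIx; have [y ny] := nonzero_coeff nIx.
have scy : sc y = sc x.
  apply: contrapT => ne; case/negP: ny; rewrite /laurent_ev /coeff big_map big_filter.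
  rewrite big_seq_cond big1// => j /andP[jL /eqP jy].
  by case: ne; rewrite -jy; exact: scL.
(* al must separate the shifts by d y' and d y, for the other paths y'
    of a different degree *)
have [|al [rgal Mal apal]] := @aperiodic_segment _ _ M sa (sc x)
  [seq (dg j.2.2, dg y) | j <- L & dg j.2.2 != dg y] Mx.
  by move=> d /mapP[j]; rewrite mem_filter => /andP[/eqP ne _] ->.
exists (T (cmp y al)), (S x * S al), (sc al), (coeff L y); split=> //.
rewrite -mulrA (mulrA b) e big_distrl big_distrr /= /laurent /coeff big_map.
rewrite big_filter big_distrl [RHS]big_mkcond big_seq [RHS]big_seq.
apply: eq_bigr => j jL; rewrite /term.
have scj : sc j.2.2 = rg al by rewrite scL.
have scyal : sc y = rg al by rewrite scy.
rewrite -!mulrA (kp2_s F)// mulrA -scal_central -mulrA;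
  rewrite [T _ * _]mulrA -U_central -[U _ * _ * _]mulrA.
case: eqP => [->|ney]; first by rewrite (kp3 F)// eqxx sc_cmp// mulrA.
suff -> : T (cmp y al) * S (cmp j.2.2 al) = 0 by rewrite !mulr0.
have [dj|dj] := eqVneq (dg j.2.2) (dg y).
  rewrite (kp3 F) ?dg_cmp ?dj//; case: eqP => // /factor_uniq[]// e'.
  by case: ney.
apply: ts_eq0 => z z'; rewrite !sc_cmp// => alz alz'.
have [|c [c1 [c2 [dal1 dal2 ne]]]] := apal (dg j.2.2, dg y).
  by apply/mapP; exists j; rewrite // mem_filter dj.
move=> ezz; apply: ne => /=.
(* the prolongations are compared beyond degree d y + d y', where one
    shows the shift of al by d y, the other the shift by d y' *)
have shift u w n n' : sc u = rg al -> sc al = rg w ->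
    dg al = n + c + n' ->
    pre c (suf (dg u + n) (cmp (cmp u al) w)) = pre c (suf n al).
  move=> uw alw dal; rewrite -cmpA// suf_cmpr ?rg_cmp//; last first.
    by exists (c + n' + dg w); rewrite dg_cmp// dal !addrA.
  have dal' : dg al = n + (c + n') by rewrite addrA.
  rewrite (suf_cmpl alw dal') (@pre_cmpl _ _ _ n')//.
    by rewrite (sc_suf dal').
  by case: (factorP dal').
rewrite -(shift y z' _ c1)// -(shift j.2.2 z _ c2)//.
by rewrite ezz addrC.
Qed.

(** An element of [J] outside the ideal would be compressed to [q(U) P_v], which
    is the nonzero scalar [q(a)] times [P_v] modulo the ideal; so [P_v] would be
    in [J]. *)
Theorem tail_ideal_maximal (J : set A) : ideal2 J -> I `<=` J ->
  (forall v, mt_set M v -> ~ J (P v)) -> J `<=` I.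
Proof.
move=> idJ IJ JP b Jb; apply: contrapT => /corner_compression.
move=> [u [w [v [q [Mv q0 e]]]]]; apply: (JP v Mv).
have Jq : J (laurent q * P v).
  by rewrite -e; apply: (ideal2Mr idJ) => //; exact: (ideal2Ml idJ).
have : J (scal A (laurent_ev a q) * P v).
  rewrite -[scal A _](subKr (laurent q)) mulrBl; apply: (ideal2B idJ) => //.
  by apply: (ideal2Mr idJ) => //; apply: IJ; exact: tail_ideal_laurent.
move=> /(ideal2Ml idJ (scal A (laurent_ev a q)^-1)).
by rewrite mulrA -rmorphM mulVf// rmorph1 mul1r.
Qed.

End Key.


Hypothesis tail_ideal_notp : forall M a v, mt_set M v -> ~ tail_ideal M a (P v).

Lemma linked_trans (u v w : vertex G) : linked u v -> linked v w -> linked u w.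
Proof.
move=> [x [<- xv]] [y [yv <-]]; exists (cmp x y).
by rewrite rg_cmp ?sc_cmp// xv yv.
Qed.

(** The third axiom of a maximal tail, applied to finitely many vertices. *)
Lemma common_target (M : maxtail G) :
  exists z, mt_set M z /\ forall v, mt_set M v -> linked v z.
Proof.
suff [z [Mz zP]] : exists z, mt_set M z /\
    forall v, v \in vertices G -> mt_set M v -> linked v z.
  by exists z; split=> // v; apply: zP; exact: mem_vertices.
elim: (vertices G) => [|v L [z [Mz zP]]].
  by have [z Mz] := mt_nonempty M; exists z.
have [Mv|Mv] := pselect (mt_set M v); last first.
  by exists z; split=> // w; rewrite inE => /predU1P[->|]; [|exact: zP].
have [w [Mw vw zw]] := mt3 Mv Mz; exists w; split=> // u.
rewrite inE => /predU1P[->//|uL Mu].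
by apply: linked_trans zw; exact: zP.
Qed.

Lemma ideal_p_linked (J : set A) v w : ideal2 J -> linked v w -> J (P v) -> J (P w).
Proof.
move=> idJ [x [<- <-]] Jv; have := kp3 F (erefl (dg x)); rewrite eqxx => <-.
by rewrite -(kp2_ps F); apply: (ideal2Ml idJ); exact: (ideal2Mr idJ).
Qed.

(** The elements [b] with [b P_z] in the ideal form a proper left ideal, which
    contains [1 - P_z]. A maximal left ideal above it gives a simple module on
    which [P_z], and so every vertex of [M] (all lead to [z]), is nonzero. The
    annihilator is then the ideal itself by [tail_ideal_maximal]. *)
Lemma tail_ideal_primitive M a : primitive (tail_ideal M a).
Proof.
have [z [Mz zP]] := common_target M; have idI := tail_ideal_ideal M a.
have [I0 _ Il Ir] := idI.
pose N0 x := tail_ideal M a (x * P z).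
have N00 : N0 0 by rewrite /N0 mul0r.
have N0B x y : N0 x -> N0 y -> N0 (x - y).
  by rewrite /N0 mulrBl; exact: (ideal2B idI).
have N0M b x : N0 x -> N0 (b * x) by rewrite /N0 -mulrA; exact: Il.
have [N [N0N maxN]] : exists N : left_ideal A, (forall x, N0 x -> N x) /\ maximal_left N.
  apply: (@exists_maximal_left _ (LeftIdeal N00 N0B N0M)).
  by rewrite /= /N0 mul1r; exact: tail_ideal_notp.
have idJ := annihilator_ideal (quotient_module N).
exists (quotient_module N); split; first exact: maximal_left_simple.
apply/seteqP; split=> [b Ib m|].
  rewrite -(mclass_repr m) scale_mclass; apply/mclass_eq0/N0N.
  by do 2!apply: (Ir).
apply: tail_ideal_maximal => //.
  move=> b Ib m; rewrite -(mclass_repr m) scale_mclass; apply/mclass_eq0/N0N.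
  by do 2!apply: (Ir).
move=> v Mv /(ideal_p_linked idJ (zP v Mv)) Jz.
have [N1 _] := maxN; apply: N1; have -> : 1 = (1 - P z) - (- 1 * P z) by rewrite mulN1r opprK subrK.
apply: lidealB.
  by apply: N0N; rewrite /N0 mulrBl mul1r (kp1 F) eqxx subrr.
apply: lidealM.
by have /(_ (mclass N 1)) := Jz; rewrite scale_mclass mulr1 => /mclass_eq0.
Qed.

Section PrimitiveIsTail.
Variable N : lmodType A.
Hypothesis sN : simple_module N.
Hypothesis U_scalar : forall i, exists c, forall m : N, (U (unitZ i) - scal A c) *: m = 0.
Local Notation J := (annihilator N).
Let idJ : ideal2 J := annihilator_ideal N.

Definition support_set : set (vertex G) := [set v | ~ J (P v)].

Lemma annihilator1 : ~ J 1.
Proof. by have [[m m0] _] := sN; move=> /(_ m); rewrite scale1r. Qed.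

Lemma support_nonempty : support_set !=set0.
Proof.
apply: contrapT => none; apply: annihilator1; rewrite -P1.
apply: (ideal2_sum idJ) => v _; apply: contrapT => nv.
by apply: none; exists v.
Qed.

Lemma support1 v w : support_set w -> linked v w -> support_set v.
Proof. by move=> Jw vw Jv; apply: Jw; exact: ideal_p_linked vw Jv. Qed.

Lemma support2 v n : support_set v -> exists x, out v n x /\ support_set (sc x).
Proof.
move=> Jv; apply: contrapT => none; apply: Jv.
rewrite (p_level rf fv F v n) -big_filter; apply: (ideal2_sum idJ) => x.
rewrite mem_filter mem_level// => /andP[/eqP xv /eqP xn].
rewrite -(kp2_sp F) -mulrA; apply: (ideal2Ml idJ); apply: (ideal2Mr idJ).
by apply: contrapT => nx; apply: none; exists x.
Qed.

(** Simplicity makes the annihilator prime: [P_v b P_w] acts by a nonzero map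
    for some [b]. A term [U_c S_x T_y] of [b] that survives between [P_v] and
    [P_w] has [x] leaving [v] and [y] leaving [w] with a common source. *)
Lemma support3 v w : support_set v -> support_set w ->
  exists z, [/\ support_set z, linked v z & linked w z].
Proof.
move=> Jv Jw.
have [b Jb] : exists b, ~ J (P v * b * P w).
  apply: contrapT => none; apply: Jv => m.
  have [m0 wm0] : exists m0 : N, P w *: m0 <> 0.
    apply: contrapT => nm; apply: Jw => m0; apply: contrapT => nm0.
    by apply: nm; exists m0.
  have [b <-] := simple_generated sN wm0 m; rewrite !scalerA.
  have : J (P v * b * P w) by apply: contrapT => nJ; apply: none; exists b.
  exact.
have [L e] := span b; rewrite e big_distrr big_distrl /= in Jb.
apply: contrapT => none; apply: Jb; apply: (ideal2_sum idJ) => -[c [d [x y]]] _ /=.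
rewrite mulrA -scal_central -!mulrA; apply: (ideal2Ml idJ).
rewrite mulrA -U_central -mulrA; apply: (ideal2Ml idJ).
rewrite -(kp2_ps F x) -(kp2_tp F y).
have [xv|xv] := eqVneq v (rg x); last first.
  rewrite !mulrA (kp1 F) (negbTE xv) !mul0r; exact: (let: And4 J0 _ _ _ := idJ in J0).
have [yw|yw] := eqVneq w (rg y); last first.
  rewrite -!mulrA (kp1 F) eq_sym (negbTE yw) !mulr0; exact: (let: And4 J0 _ _ _ := idJ in J0).
have [xy|xy] := pselect (sc x = sc y); last first.
  rewrite -!mulrA (mulrA (S x)) (st0 F xy) mul0r !mulr0; exact: (let: And4 J0 _ _ _ := idJ in J0).
rewrite -(kp2_sp F x) !mulrA; do 3!apply: (ideal2Mr idJ); apply: (ideal2Ml idJ).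
apply: contrapT => nz; apply: none; exists (sc x); split=> //.
- by exists x; rewrite -xv.
- by exists y; rewrite -yw -xy.
Qed.

Definition support_tail : maxtail G :=
  MaxTail support_nonempty support1 support2 support3.

Lemma annihilator_tail_ideal : exists M a, J = tail_ideal M a.
Proof.
have [c cP] := choice U_scalar.
have c0 i : c i != 0.
  apply/eqP => ci; apply: annihilator1 => m; have := cP i m.
  rewrite ci rmorph0 subr0 => /(congr1 (fun x => U (- unitZ i) *: x)).
  by rewrite scaler0 scalerA UNK scale1r => ->.
pose a := Torus c0; exists support_tail, a.
have IJ : tail_ideal support_tail a `<=` J.
  move=> b; apply; split=> // _ [[v /= Jv <-]|[i _ <-]].
    exact: contrapT.
  exact: cP.
by apply/seteqP; split=> //; exact: tail_ideal_maximal.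
Qed.

End PrimitiveIsTail.

Lemma maxtail_ext (M M' : maxtail G) : mt_set M = mt_set M' -> M = M'.
Proof.
case: M M' => s1 a1 b1 c1 d1 [s2 a2 b2 c2 d2] /= e; move: a1 b1 c1 d1 a2 b2 c2 d2.
by rewrite e => *; congr MaxTail; exact: Prop_irrelevance.
Qed.

Lemma torus_ext (a a' : torus K r) : (forall i, a i = a' i) -> a = a'.
Proof.
case: a a' => s1 a1 [s2 a2] /= /funext e; move: a1 a2.
by rewrite e => *; congr Torus; exact: Prop_irrelevance.
Qed.

Lemma tail_ideal_proper M a : ~ tail_ideal M a 1.
Proof.
have [v Mv] := mt_nonempty M => I1; apply: (tail_ideal_notp (a := a) Mv).
by rewrite -[P v]mulr1; apply: (ideal2Ml (tail_ideal_ideal M a)).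
Qed.

Lemma tail_ideal_scal M a c : tail_ideal M a (scal A c) -> c = 0.
Proof.
move=> Ic; apply/eqP; apply: contrapT => /negP c0; apply: (@tail_ideal_proper M a).
by rewrite -(rmorph1 (scal A)) -(mulVf c0) rmorphM; apply: (ideal2Ml (tail_ideal_ideal M a)).
Qed.

Lemma tail_ideal_pE M a v : tail_ideal M a (P v) <-> ~ mt_set M v.
Proof.
split; last exact: tail_ideal_p.
by move=> Iv Mv; exact: tail_ideal_notp Mv Iv.
Qed.

Lemma tail_ideal_laurentE M a q :
  tail_ideal M a (laurent q) <-> laurent_ev a q = 0.
Proof.
have idI := tail_ideal_ideal M a; have cq := @tail_ideal_laurent M a q.
split=> [Iq|e]; last by rewrite e rmorph0 subr0 in cq.
apply: (@tail_ideal_scal M a); rewrite -[scal A _](subKr (laurent q)).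
exact: (ideal2B idI).
Qed.

Lemma tail_ideal_inj M a M' a' : tail_ideal M a = tail_ideal M' a' -> M = M' /\ a = a'.
Proof.
move=> e; split.
  apply: maxtail_ext; apply/seteqP; split=> v Mv; apply: contrapT => nMv.
    have := @tail_ideal_p M' a' v nMv; rewrite -e; exact: tail_ideal_notp.
  have := @tail_ideal_p M a v nMv; rewrite e; exact: tail_ideal_notp.
apply: torus_ext => i; apply/eqP; rewrite -subr_eq0; apply/eqP.
apply: (@tail_ideal_scal M a); rewrite rmorphB.
have -> : scal A (a i) - scal A (a' i) = (U (unitZ i) - scal A (a' i)) - (U (unitZ i) - scal A (a i)).
  by rewrite opprB [RHS]addrC addrA subrK.
apply: (ideal2B (tail_ideal_ideal M a)); last exact: tail_ideal_U.
by rewrite e; exact: tail_ideal_U.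
Qed.

(** The identity of [corner_compression] holds in [A], so it excludes [b] from
    the ideal of every tail through [v] and every point where [q] does not
    vanish. *)
Lemma notin_tail_ideal_open M a b : ~ tail_ideal M a b -> exists v q,
  [/\ mt_set M v, laurent_ev a q != 0 & forall M' a', mt_set M' v ->
     laurent_ev a' q != 0 -> ~ tail_ideal M' a' b].
Proof.
move=> /corner_compression[u [w [v [q [Mv q0 e]]]]]; exists v, q; split=> // M' a' M'v q'0 Ib.
have idI := tail_ideal_ideal M' a'; apply: (tail_ideal_notp (a := a') M'v).
have Jq : tail_ideal M' a' (laurent q * P v).
  by rewrite -e; apply: (ideal2Mr idI); exact: (ideal2Ml idI).
have : tail_ideal M' a' (scal A (laurent_ev a' q) * P v).
  rewrite -[scal A _](subKr (laurent q)) mulrBl; apply: (ideal2B idI) => //.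
  by apply: (ideal2Mr idI); exact: tail_ideal_laurent.
move=> /(ideal2Ml idI (scal A (laurent_ev a' q)^-1)).
by rewrite mulrA -rmorphM mulVf// rmorph1 mul1r.
Qed.

End Core.

(** * Splitting off the torus *)

Section Splitting.
Variables (K : fieldType) (k l : nat) (f : {additive NN k -> NN l}).
Variables (G : kgraph l) (A : ualg K).
Variables (p : vertex (pullback f G) -> A) (s t : kpath (pullback f G) -> A).
Variables (r : nat) (h : 'I_r -> ZZ k).
Hypothesis f_surj : forall m : NN l, exists n : NN k, f n = m.
Hypotheses (rf : row_finite G) (fv : finite_set [set: vertex G]).
Hypothesis KP : is_KP p s t.
Hypothesis hbasis : zbasis [set x | fbar f x = 0] h.
Implicit Types (x y : kpath G) (m n : NN k) (c d : ZZ r).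

Local Notation g := (msection f_surj).
Let F : KP_family p s t := proj1 KP.
Let rfp : row_finite (pullback f G) := pullback_out_finite rf.
Let p1 : vsum p = 1 := vsum1 rfp fv KP.

Definition basis_sum c : ZZ k := \sum_(i < r) h i *~ c i.
(** Coordinates in the given basis of the kernel; the default value is only taken
    outside the kernel. *)
Definition coord (z : ZZ k) : ZZ r := xget 0 [set c | z = basis_sum c].

Lemma basis_sumD c d : basis_sum (c + d) = basis_sum c + basis_sum d.
Proof.
by rewrite -big_split; apply: eq_bigr => i _; rewrite ffunE mulrzDr.
Qed.

Lemma basis_sum0 : basis_sum 0 = 0.
Proof. by apply: big1 => i _; rewrite ffunE mulr0z. Qed.

Lemma basis_sum_unit i : basis_sum (unitZ i) = h i.
Proof.
rewrite /basis_sum (bigD1 i)//= big1 ?addr0 ?ffunE ?eqxx// => j ji.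
by rewrite ffunE eq_sym (negbTE ji).
Qed.

Lemma fbar_basis_sum c : fbar f (basis_sum c) = 0.
Proof.
rewrite raddf_sum big1// => i _; rewrite raddfMz.
by have [/(_ i) /= -> _] := hbasis; rewrite mul0rz.
Qed.

Lemma basis_sumK c : coord (basis_sum c) = c.
Proof.
have [_ /(_ (basis_sum c) (fbar_basis_sum c))[d [_ u]]] := hbasis.
rewrite /coord; case: xgetP => [c' _ /= e|/(_ c) []//].
by rewrite -(u c')// (u c).
Qed.

Lemma coordK z : fbar f z = 0 -> basis_sum (coord z) = z.
Proof.
move=> z0; have [_ /(_ z z0)[d [e _]]] := hbasis.
by rewrite /coord; case: xgetP => [c' _ /= <-//|/(_ d) []].
Qed.

Lemma coordD z z' : fbar f z = 0 -> fbar f z' = 0 ->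
  coord (z + z') = coord z + coord z'.
Proof.
by move=> /coordK e /coordK e'; rewrite -[LHS]/(coord _) -{1}e -{1}e' -basis_sumD basis_sumK.
Qed.

Definition lattice_unit c : A := degshift s t (posp (basis_sum c)) (negp (basis_sum c)).

Lemma f_posneg c : f (posp (basis_sum c)) = f (negp (basis_sum c)).
Proof. by apply/fbar_eq0; rewrite pospB fbar_basis_sum. Qed.

Lemma degshift_lattice m n : f m = f n -> degshift s t m n = lattice_unit (coord (toZZ m - toZZ n)).
Proof.
move=> mn; apply: (degshift_eq rf fv rfp F p1) => //; first exact: f_posneg.
rewrite coordK; last exact/fbar_eq0.
symmetry; apply: toZZ_inj; rewrite !toZZD; apply/eqP.
by rewrite -subr_eq addrAC pospB subrK.
Qed.

Lemma lattice_unit_Uelt i : lattice_unit (unitZ i) = Uelt s t (h i).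
Proof. by rewrite -[h i]basis_sum_unit (Uelt_degshift _ _ rf fv (f_posneg _)). Qed.

Lemma lattice_unit0 : lattice_unit 0 = 1.
Proof.
rewrite -(degshift_id rf fv rfp F p1 0) degshift_lattice// subrr; congr lattice_unit.
by rewrite -[LHS]basis_sumK basis_sum0.
Qed.

Lemma lattice_unitD c d : lattice_unit (c + d) = lattice_unit c * lattice_unit d.
Proof.
rewrite [RHS](degshift_add rf fv rfp F p1) ?f_posneg// degshift_lattice; last first.
  by rewrite !(raddfD f) !f_posneg.
by rewrite !toZZD opprD addrACA !pospB -basis_sumD basis_sumK.
Qed.

Lemma lattice_unit_central c a : lattice_unit c * a = a * lattice_unit c.
Proof. by apply: (degshift_central rf fv rfp F p1); [exact: (span_full rfp fv KP)|exact: f_posneg]. Qed.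

(** Evaluating at the degrees in the image of the section turns the family of
    the pullback into one for [G]. *)
Definition section_s x : A := gen_at s x (g (dg x)).
Definition section_t x : A := gen_at t x (g (dg x)).
Local Notation P := (p : vertex G -> A).

Let gK := msectionK f_surj.

Lemma section_family : @KP_family _ G _ A P section_s section_t.
Proof.
split.
- by move=> v; rewrite /section_s dg_idp msection0; exact: (lift_s_idp F).
- by move=> v; rewrite /section_t dg_idp msection0; exact: (lift_t_idp F).
- exact: kp1 F.
- move=> x y xy; rewrite /section_s (lift_sM F)// ?gK//.
  by rewrite dg_cmp// msectionD.
- move=> x y xy; rewrite /section_t (lift_tM F)// ?gK//.
  by rewrite dg_cmp// msectionD.
- by move=> x; exact: (lift_ps F).
- by move=> x; exact: (lift_sp F).
- by move=> x; exact: (lift_pt F).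
- by move=> x; exact: (lift_tp F).
- by move=> x y xy; rewrite /section_s /section_t xy; apply: (lift_ts F); rewrite gK.
- move=> v n _; rewrite out_sum// -[LHS]mulr1 (one_level rf fv rfp F p1 (g n)).
  rewrite gK big_distrr [RHS]big_mkcond /= [LHS]big_seq [RHS]big_seq; apply: eq_bigr => x.
  rewrite mem_level// => /eqP dx; rewrite /section_s /section_t dx -(lift_ps F x) !mulrA (kp1 F).
  by rewrite eq_sym; case: eqP => [->|_]; rewrite ?mul0r.
Qed.

Lemma section_vsum : @vsum _ G _ A P = 1. Proof. exact: p1. Qed.

Lemma lift_s_section x n : dg x = f n -> gen_at s x n = lattice_unit (coord (toZZ n - toZZ (g (f n)))) * section_s x.
Proof. by move=> dx; rewrite -degshift_lattice ?gK// /section_s dx (degshift_s0 rf fv F)// gK. Qed.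

Lemma lift_t_section x n : dg x = f n -> gen_at t x n = lattice_unit (coord (toZZ (g (f n)) - toZZ n)) * section_t x.
Proof.
by move=> dx; rewrite -degshift_lattice ?gK// /section_t dx -(t_degshift0 rf fv F (m := g (f n))) ?gK//
  (degshift_central rf fv rfp F p1)// ?gK//; exact: (span_full rfp fv KP).
Qed.

(** The remaining generators differ from these by central units. *)
Lemma section_span a : combo (fun j : ZZ r * (kpath G * kpath G) => lattice_unit j.1 * section_s j.2.1 * section_t j.2.2) a.
Proof.
have [L ->] := span_full rfp fv KP a; apply: combo_sum => -[c [z z']] _ /=.
apply: comboZ; rewrite [s z]gen_at_val [t z']gen_at_val.
rewrite lift_s_section ?lift_t_section; [|by apply/eqP; exact: (valP z')|by apply/eqP; exact: (valP z)].
rewrite mulrA -(mulrA _ (section_s _)) -lattice_unit_central mulrA -lattice_unitD.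
exact: (combo_gen (fun j : ZZ r * (kpath G * kpath G) => lattice_unit j.1 * section_s j.2.1 * section_t j.2.2) (_, (_, _))).
Qed.

Section Nonvanishing.
Variables (T : maxtail G) (a : torus K r).

Lemma PTa_tail_ideal : PTa p s t h T a = tail_ideal P lattice_unit T a.
Proof.
rewrite /PTa /tail_ideal; congr (smallest _ (_ `|` _)).
by congr image; apply/funext => i; rewrite lattice_unit_Uelt.
Qed.

(** The character [ev a] of the kernel extended to [N^k], trivially on the image
    of the section. *)
Definition chi n : K := ev a (coord (toZZ n - toZZ (g (f n)))).

Lemma chi_in n : fbar f (toZZ n - toZZ (g (f n))) = 0.
Proof. by apply/fbar_eq0; rewrite gK. Qed.

Lemma chi0 : chi 0 = 1.
Proof.
rewrite /chi raddf0 msection0 subrr.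
by rewrite -basis_sum0 basis_sumK ev0.
Qed.

Lemma chiD m n : chi (m + n) = chi m * chi n.
Proof.
rewrite /chi -evD -coordD ?chi_in// raddfD msectionD !toZZD opprD.
by rewrite addrACA.
Qed.

Lemma chi_neq0 n : chi n != 0. Proof. exact: ev_neq0. Qed.

(** The representation twisted by [chi] annihilates the generators of the ideal,
    whereas [P_v] acts as the indicator of the infinite paths from [v] inside the
    tail, and such a path exists. *)
Lemma vertex_notin_tail_ideal : strongly_aperiodic G ->
  forall v, mt_set T v -> ~ tail_ideal P lattice_unit T a (P v).
Proof.
move=> sa v Tv.
have T1 v' w : mt_set T w -> linked v' w -> mt_set T v' by exact: mt1.
have TF := twisted_family f T1 rf chi_neq0 chi0 chiD.
have [phi [[[phiD phiM phiZ] phiP phiS phiT] _]] := (proj2 KP) _ _ _ _ TF.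
have phi0 : phi 0 = 0.
  by apply: (addIr (phi 0)); rewrite -phiD !addr0 add0r.
have phiN (b : A) : phi (- b) = - phi b.
  by apply/eqP; rewrite -addr_eq0 -phiD addNr phi0.
have phi_sum I (L : seq I) (E : I -> A) : phi (\sum_(i <- L) E i) = \sum_(i <- L) phi (E i).
  by rewrite (big_morph phi phiD phi0).
move=> Iv; have : phi (P v) = 0.
  apply: (Iv [set b | phi b = 0]); split.
    split => //=.
    - by move=> x y x0 y0; rewrite phiD x0 y0 addr0.
    - by move=> b x x0; rewrite phiM x0 mulr0.
    - by move=> b x x0; rewrite phiM x0 mul0r.
  move=> _ [[w Tw <-]|[i _ <-]] /=.
    rewrite phiP /twisted_p; apply: endo_fun_ext => u y; rewrite /= /fun_p.
    case: eqP => // yw; case: Tw; rewrite -yw -[brg y](bp_rg y 0).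
    apply: mt1 (bp_T y 0) _; exists (y 0); split=> //; exact: bp_rg.
  have phiW m m' : f m = f m' ->
      phi (degshift s t m m') = scal _ (chi m / chi m') * \sum_(x <- level G (f m)) (op_s K (mt_set T) x * op_t K T1 x : endo_alg _).
    move=> mm'; rewrite phi_sum big_distrr big_seq [RHS]big_seq; apply: eq_bigr => x.
    rewrite mem_level// => /eqP dx; rewrite phiM.
    rewrite (gen_atE s (introT eqP dx)) phiS.
    have dx' : dg x = f m' by rewrite dx.
    by rewrite (gen_atE t (introT eqP dx')) phiT /twisted_s /twisted_t scalM_swap.
  rewrite phiD phiN -[scal A (a i)]mulr1 phiZ.
  have -> : phi 1 = phi (degshift s t (negp (basis_sum (unitZ i))) (negp (basis_sum (unitZ i)))).
    by rewrite (degshift_id rf fv rfp F p1).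
  rewrite !phiW ?f_posneg// divff ?chi_neq0// rmorph1 mul1r.
  suff -> : chi (posp (basis_sum (unitZ i))) / chi (negp (basis_sum (unitZ i))) = a i.
    by rewrite subrr.
  apply: (mulIf (chi_neq0 (negp (basis_sum (unitZ i))))); rewrite divfK ?chi_neq0//.
  rewrite /chi -[a i]ev_unit -evD -[X in ev _ (X + _)](basis_sumK (unitZ i)).
  rewrite -coordD ?chi_in ?fbar_basis_sum//; congr (ev _ (coord _)).
  rewrite f_posneg addrA; congr (_ - _).
  by apply/eqP; rewrite -subr_eq pospB.
rewrite phiP => /(congr1 (fun e : endo (path_functions K (mt_set T)) => e (fun=> 1))).
have [y [yv _]] := aperiodic_bpath sa Tv.
move=> /(congr1 (fun u => u y)); rewrite /= /fun_p yv eqxx => /eqP.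
by rewrite oner_eq0.
Qed.

End Nonvanishing.

End Splitting.

(** * The primitive ideal space *)

Section LaurentPolynomials.
Variables (K : fieldType) (r : nat).

Definition laurent_of_mpoly (q : {mpoly K[r]}) : seq (K * ZZ r) :=
  [seq (q@_m, [ffun i => Posz (m i)]) | m <- msupp q].

Lemma laurent_of_mpolyE q (a : torus K r) :
  laurent_ev a (laurent_of_mpoly q) = q.@[a].
Proof.
rewrite mevalE /laurent_ev /laurent_of_mpoly big_map; apply: eq_bigr => m _ /=.
by congr (_ * _); apply: eq_bigr => i _; rewrite ffunE.
Qed.

(** Multiplication by a monomial makes all exponents nonnegative, and monomials
    do not vanish on the torus. *)
Lemma laurent_clear_denominators (q : seq (K * ZZ r)) :
  exists N (q' : {mpoly K[r]}), forall a : torus K r,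
    q'.@[a] = (\prod_i a i) ^+ N * laurent_ev a q.
Proof.
elim: q => [|[c d] q [N [q' IH]]].
  by exists 0%N, 0 => a; rewrite meval0 /laurent_ev big_nil mulr0.
(* D bounds every exponent of the new term in absolute value *)
pose D := (\sum_i absz (d i))%N.
pose m : 'X_{1..r} := [multinom absz (d i + Posz (N + D)%N)%R | i < r].
exists (N + D)%N, (c *: 'X_[m] + q' * (\prod_i 'X_i) ^+ D) => a.
rewrite mevalD mevalZ mevalX mevalM IH rmorphXn /=.
have -> : (\prod_i 'X_i : {mpoly K[r]}).@[a] = \prod_i a i.
  by rewrite rmorph_prod; apply: eq_bigr => i _; rewrite /= mevalXU.
rewrite /laurent_ev big_cons mulrDr; congr (_ + _); last first.
  by rewrite mulrAC -exprD.
rewrite mulrCA; congr (_ * _).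
rewrite -prodrXl -big_split; apply: eq_bigr => i _ /=.
rewrite mnmE -[a i ^+ (N + D)]/(a i ^ Posz (N + D)) -expfzDr ?tvalP// addrC.
have dD : (absz (d i) <= D)%N by rewrite /D (bigD1 i)//= leq_addr.
rewrite -[LHS]/(a i ^ Posz _); congr (_ ^ _).
by case: (d i) dD => n /= dD; rewrite ?NegzE; lia.
Qed.

Lemma laurent_nonzero_open (q : seq (K * ZZ r)) :
  open [set a : torus K r | laurent_ev a q != 0].
Proof.
have [N [q' e]] := laurent_clear_denominators q.
exists [set q']; apply/seteqP; split=> a /=.
  move=> /negP; rewrite negbK => /eqP a0 _ ->.
  by rewrite e a0 mulr0.
move=> /(_ q' erefl); rewrite e => /eqP; rewrite mulf_eq0 => /orP[|/eqP->].
  rewrite expf_eq0 => /andP[_]; rewrite (negbTE (_ : \prod_i a i != 0))//.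
  by apply/prodf_neq0 => i _; exact: tvalP.
by rewrite eqxx.
Qed.

End LaurentPolynomials.

Section Hulls.
Variable A : pzRingType.

Lemma Prim_ext (Q Q' : Prim A) : pideal Q = pideal Q' -> Q = Q'.
Proof.
case: Q Q' => s a [s' a'] /= e; move: a a'; rewrite e => a a'.
by congr MkPrim; exact: Prop_irrelevance.
Qed.

Lemma primitive_ideal2 (Q : set A) : primitive Q -> ideal2 Q.
Proof. by move=> [N [_ ->]]; exact: annihilator_ideal. Qed.

Lemma open_avoiding (S : set A) : open (~` [set Q : Prim A | S `<=` pideal Q]).
Proof.
exists (smallest (@ideal2 A) S); split; first exact: ideal2_smallest.
rewrite setCK; apply/seteqP; split=> Q /= SQ.
  by move=> b; apply; split=> //; exact: primitive_ideal2 (pidealP Q).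
by move=> b Sb; apply: SQ => J [_]; apply.
Qed.

End Hulls.

Lemma tails_at_open k (G : kgraph k) (v : vertex G) : open (tails_at v).
Proof.
exists [set Some v] => //.
by rewrite bigcup_set1.
Qed.

Section Parametrisation.
Variables (K : fieldType) (l : nat) (G : kgraph l) (A : ualg K) (r : nat).
Variables (P : vertex G -> A) (U : ZZ r -> A).
Local Notation TI := (tail_ideal P U).
Hypothesis TI_primitive : forall M a, primitive (TI M a).
Hypothesis TI_exhaust : forall Q, primitive Q -> exists M a, Q = TI M a.
Hypothesis TI_inj : forall M a M' a', TI M a = TI M' a' -> M = M' /\ a = a'.
Hypothesis TI_p : forall M a v, TI M a (P v) <-> ~ mt_set M v.
Hypothesis TI_laurent : forall M a q, TI M a (laurent U q) <-> laurent_ev a q = 0.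
Hypothesis TI_open : forall M a b, ~ TI M a b -> exists v q,
  [/\ mt_set M v, laurent_ev a q != 0 & forall M' a', mt_set M' v ->
     laurent_ev a' q != 0 -> ~ TI M' a' b].

Definition prim_of (Ma : maxtail G * torus K r) : Prim A :=
  MkPrim (TI_primitive Ma.1 Ma.2).

(** A point outside the closed set of an ideal is witnessed by one [b] in that
    ideal, to which [notin_tail_ideal_open] applies. *)
Lemma prim_of_continuous : continuous prim_of.
Proof.
apply/continuousP => O [I [idI OI]]; rewrite openE => -[M a] /= OMa.
have [b [Ib nb]] : exists b, I b /\ ~ TI M a b.
  apply: contrapT => none; suff : (~` O) (prim_of (M, a)) by [].
  rewrite OI => b Ib; apply: contrapT => nb; by apply: none; exists b.
have [v [q [Mv qa ball]]] := TI_open nb.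
exists (tails_at v, [set a | laurent_ev a q != 0]) => /=.
  split; apply: open_nbhs_nbhs; split=> //; first exact: tails_at_open.
  exact: laurent_nonzero_open.
move=> [M' a'] /= [M'v qa']; apply: contrapT => nO.
have : (~` O) (prim_of (M', a')) by [].
rewrite OI => /(_ b Ib) /=; exact: ball.
Qed.

(** The two coordinates of the inverse are continuous because the defining closed
    sets of tails and of points correspond to hulls, of vertices and of Laurent
    polynomials in the units. *)
Lemma prim_of_homeomorphism : homeomorphism prim_of.
Proof.
have surj Q : exists Ma, prim_of Ma = Q.
  by have [M [a e]] := TI_exhaust (pidealP Q); exists (M, a); apply: Prim_ext.
have [g gK] := choice surj.
have gE Q : pideal Q = TI (g Q).1 (g Q).2 by rewrite -[in LHS](gK Q).
exists g; split=> //.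
- move=> [M a]; have := congr1 (@pideal _) (gK (prim_of (M, a))).
  by case: (g _) => M' a' /= /TI_inj[-> ->].
- exact: prim_of_continuous.
have g1 : continuous (fun Q => (g Q).1).
  apply/continuousP => O [D _ <-]; rewrite preimage_bigcup; apply: bigcup_open.
  move=> [v|] _ /=; last by rewrite preimage_set0; exact: open0.
  have -> : (fun Q => (g Q).1) @^-1` tails_at v = ~` [set Q : Prim A | [set P v] `<=` pideal Q].
    apply/seteqP; split=> Q /=.
      by move=> Mv /(_ _ erefl); rewrite gE => /TI_p.
    by move=> nQ; apply: contrapT => nv; apply: nQ => _ ->; rewrite gE; exact/TI_p.
  exact: open_avoiding.
have g2 : continuous (fun Q => (g Q).2).
  apply/continuousP => O [S OS].
  have -> : (fun Q => (g Q).2) @^-1` O =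
     ~` [set Q : Prim A | [set laurent U (laurent_of_mpoly q) | q in S] `<=` pideal Q].
    rewrite -[LHS]setCK preimage_setC OS; congr (~` _); apply/seteqP; split=> Q /=.
      move=> Z _ [q Sq <-]; rewrite gE; apply/TI_laurent.
      by rewrite laurent_of_mpolyE; exact: Z.
    move=> sub q Sq; rewrite -laurent_of_mpolyE; apply/(TI_laurent (g Q).1).
    by rewrite -gE; apply: sub; exists q.
  exact: open_avoiding.
move=> Q B [[B1 B2] /= [/g1 Q1 /g2 Q2] sub].
have Q12 : nbhs Q ([set Q' | B1 (g Q').1] `&` [set Q' | B2 (g Q').2]).
  by apply: filterI; [exact: Q1|exact: Q2].
apply: (filterS _ Q12) => Q' [/= Q'1 Q'2]; exact: (sub (g Q')).
Qed.

End Parametrisation.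

Theorem corollary5p4 (K : closedFieldType) (k l : nat)
    (f : {additive NN k -> NN l}) (G : kgraph l)
    (A : ualg K) (p : vertex (pullback f G) -> A)
    (s t : kpath (pullback f G) -> A)
    (r : nat) (h : 'I_r -> ZZ k) :
  ~ countable [set: K] ->
  (forall m : NN l, exists n : NN k, f n = m) ->
  row_finite G -> no_sources G -> finite_set [set: vertex G] ->
  strongly_aperiodic G ->
  is_KP p s t ->
  zbasis [set x | fbar f x = 0] h ->
  (forall P : set A, primitive P <->
     exists (T : maxtail G) (a : torus K r), P = PTa p s t h T a) /\
  exists phi : maxtail G * torus K r -> Prim A,
    (forall T a, pideal (phi (T, a)) = PTa p s t h T a) /\
    homeomorphism phi.
Proof.
move=> uK f_surj rf _ fv sa KP hb.
have F := section_family f_surj rf fv KP.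
have P1 := section_vsum rf fv KP.
have U0 := lattice_unit0 rf fv KP hb.
have UD := lattice_unitD rf fv KP hb.
have UC := lattice_unit_central rf fv KP hb.
have span := section_span f_surj rf fv KP hb.
have nz M a v := vertex_notin_tail_ideal f_surj rf fv KP hb (T := M) (a := a) sa (v := v).
pose TI := tail_ideal (p : vertex G -> A) (lattice_unit s t h).
have PE T a : PTa p s t h T a = TI T a  by apply: PTa_tail_ideal.
have prim M a : primitive (TI M a).
  by apply: (tail_ideal_primitive rf fv F P1 U0 UD UC span sa).
have exh Q : primitive Q -> exists M a, Q = TI M a.
  move=> [N [sN ->]]; apply: (annihilator_tail_ideal rf fv F P1 U0 UD UC span sa sN).
  by move=> i; apply: (central_scalar uK span sN); exact: UC.
split.
  move=> Q; split=> [/exh[M [a ->]]|[M [a ->]]]; last by rewrite PE.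
  by exists M, a; rewrite PE.
exists (prim_of prim); split; first by move=> T a; rewrite PE.
apply: prim_of_homeomorphism => //.
- exact: (tail_ideal_inj nz).
- exact: (tail_ideal_pE nz).
- exact: (tail_ideal_laurentE U0 UD nz).
- by apply: (notin_tail_ideal_open rf fv F P1 U0 UD UC span sa nz).
Qed.
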